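(* Let $\mathcal H$ be a Hilbert space, let $n\ge 2$ and let $X_1,\dots,X_{n-1}\in B(\mathcal H)$. Then $w(X_1,\dots,X_{n-1})<\tfrac12$ if and only if there exist positive invertible operators $A_1,\dots,A_n\in B(\mathcal H)$ with $A_1+\cdots+A_n=I$ such that the tridiagonal operator matrix $$\begin{bmatrix} A_1 & X_1 & 0 & \cdots & 0\\ X_1^* & A_2 & X_2 & & \vdots\\ 0 & X_2^* & \ddots & \ddots & 0\\ \vdots & & \ddots & A_{n-1} & X_{n-1}\\ 0 & \cdots & 0 & X_{n-1}^* & A_n\end{bmatrix}$$ is positive and invertible in $M_n(B(\mathcal H))=B(\mathcal H^{(n)})$.
   Context: The numerical radius of an operator $X$ on a Hilbert space $\mathcal H$ is $w(X)=\sup\{|\langle X\xi,\xi\rangle|:\xi\in\mathcal H,\ \|\xi\|=1\}$. The free joint numerical radius of operators $X_1,\dots,X_m\in B(\mathcal H)$ is $$w(X_1,\dots,X_m)=\sup\{w(X_1\otimes U_1+\cdots+X_m\otimes U_m)\},$$ where the supremum is over every Hilbert space $\mathcal K$ and every choice of $m$ unitaries $U_1,\dots,U_m\in B(\mathcal K)$, and the tensor product is spatial (operators act on $\mathcal H\otimes\mathcal K$). $\mathcal H^{(n)}$ is the direct sum of $n$ copies of $\mathcal H$. *)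

(* Defs.v *)
From HB Require Import structures.
From mathcomp Require Import all_boot all_order all_algebra.
From mathcomp Require Import complex.
From mathcomp Require Import boolp classical_sets functions reals ereal.
From mathcomp Require Import topology normedtype.

Set Implicit Arguments.
Unset Strict Implicit.
Unset Printing Implicit Defensive.

Import Order.TTheory GRing.Theory Num.Theory.
Import numFieldNormedType.Exports.

Local Open Scope classical_set_scope.
Local Open Scope ring_scope.
Local Open Scope complex_scope.

(* The inner product is linear in its first argument (and conjugate-linear in
   its second); norms over R[i] take their values in R[i]. *)
HB.mixin Record isHilbert (R : realType) H & CompleteNormedModule R[i] H := {
  inner : {dot H for (@Num.conj R[i])};
  inner_norm : forall x : H, inner x x = `|x| ^+ 2
}.

#[short(type="hilbertType")]
HB.structure Definition Hilbert (R : realType) :=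
  {H of CompleteNormedModule R[i] H & isHilbert R H}.

Notation "'<<' x , y '>>'" := (inner x y)
  (at level 0, x at level 99, y at level 99, format "<< x ,  y >>") : ring_scope.

Section DotCauchySchwarz.
Variables (C : numClosedFieldType) (U : lmodType C) (f : {dot U for (@Num.conj C)}).

Let dot_proj_aux (a b c : C) : 0 < b ->
  c + `|a / b| ^+ 2 * b - ((a / b)^*%R * a + ((a / b)^*%R * a)^*%R) =
  c - `|a| ^+ 2 / b.
Proof.
move=> b0; have br : b^*%R = b by apply/CrealP/ger0_real/ltW.
have -> : (a / b)^*%R * a = `|a| ^+ 2 / b.
  by rewrite rmorphM/= fmorphV/= br mulrAC [_ * a]mulrC -normCK.
have -> : `|a / b| ^+ 2 * b = `|a| ^+ 2 / b.
  rewrite normrM normfV (gtr0_norm b0) exprMn -mulrA [b^-1 ^+ 2]expr2 -!mulrA.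
  by rewrite (mulVf (lt0r_neq0 b0)) mulr1.
have -> : (`|a| ^+ 2 / b)^*%R = `|a| ^+ 2 / b.
  by apply/CrealP/ger0_real/divr_ge0; rewrite ?exprn_ge0// ltW.
by rewrite opprD addrA addrK.
Qed.

Lemma dot_conj u v : f u v = (f v u)^*%R.
Proof. by rewrite (hermC f) expr0 mul1r. Qed.

Lemma dot_proj u v : v != 0 ->
  f (u - (f u v / f v v) *: v) (u - (f u v / f v v) *: v) =
  f u u - `|f u v| ^+ 2 / f v v.
Proof.
move=> v0; have fv : 0 < f v v by exact: neq0_dnorm_gt0.
by rewrite dnormB dnormZ linearZr_LR/=; exact: dot_proj_aux.
Qed.

Lemma dot_CauchySchwarz u v : `|f u v| ^+ 2 <= f u u * f v v.
Proof.
have [->|v0] := eqVneq v 0.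
  by rewrite !linear0r mulr0 normr0 expr0n.
have fv : 0 < f v v by exact: neq0_dnorm_gt0.
have := dnorm_ge0 f (u - (f u v / f v v) *: v).
by rewrite (dot_proj _ v0) subr_ge0 => h; rewrite -ler_pdivrMr.
Qed.

Let ler_normD_aux (p q d : C) : 0 <= p -> 0 <= q ->
  `|d| ^+ 2 <= p ^+ 2 * q ^+ 2 -> p ^+ 2 + q ^+ 2 + (d + d^*%R) <= (p + q) ^+ 2.
Proof.
move=> p0 q0; rewrite -exprMn ler_pXn2r ?nnegrE ?mulr_ge0// => dpq.
rewrite sqrrD addrAC lerD2r lerD2l.
have dr : d + d^*%R \is Num.real by rewrite CrealE rmorphD/= conjCK addrC.
apply: le_trans (real_ler_norm dr) (le_trans (ler_normD _ _) _).
by rewrite norm_conjC -mulr2n lerMn2r.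
Qed.

Lemma dot_ler_normD u v :
  sqrtC (f (u + v) (u + v)) <= sqrtC (f u u) + sqrtC (f v v).
Proof.
have su w := sqrt_dnorm_ge0 f w.
rewrite -(@ler_pXn2r _ 2)// ?nnegrE ?addr_ge0 ?su// sqrtCK dnormD.
rewrite -[X in X + f v v + _]sqrtCK -[X in _ + X + _]sqrtCK.
by apply: ler_normD_aux; rewrite ?su// !sqrtCK; exact: dot_CauchySchwarz.
Qed.
End DotCauchySchwarz.

(* H^(n); the {ffun _ -> _} alias carries the l2 norm. *)
Definition hsum (R : realType) (H : hilbertType R) (n : nat) : Type :=
  {ffun 'I_n -> H}.

Section HilbertSum.
Variables (R : realType) (H : hilbertType R) (n : nat).
Local Notation C := R[i].
Local Notation V := (hsum H n).

HB.instance Definition _ := GRing.Lmodule.on V.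

Definition hsum_inner (x y : V) : C := \sum_i <<x i, y i>>.

Let hsum_inner_bilinear :
  bilinear_for *%R (@Num.conj C \; *%R) hsum_inner.
Proof.
split=> u a x y.
  rewrite /hsum_inner/= mulr_sumr -big_split/=.
  by apply: eq_bigr => i _; rewrite !ffunE linearPl.
rewrite /hsum_inner/= mulr_sumr -big_split/=.
by apply: eq_bigr => i _; rewrite !ffunE linearPr.
Qed.

HB.instance Definition _ := bilinear_isBilinear.Build C V V C
  *%R (@Num.conj C \; *%R) hsum_inner hsum_inner_bilinear.

Let hsum_inner_sym x y :
  hsum_inner x y = (-1) ^+ false * (hsum_inner y x)^*%R.
Proof.
rewrite expr0 mul1r rmorph_sum/=.
by apply: eq_bigr => i _; exact: dot_conj.
Qed.

HB.instance Definition _ :=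
  isHermitianSesquilinear.Build C V false (@Num.conj C) hsum_inner hsum_inner_sym.

Let hsum_inner_gt0 u : u != 0 -> 0 < hsum_inner u u.
Proof.
move=> u0; have ge0 i : 0 <= <<u i, u i>> by exact: dnorm_ge0.
rewrite lt0r sumr_ge0// andbT; apply: contra u0 => /eqP u0.
apply/eqP/ffunP => i; rewrite ffunE; apply/eqP.
by rewrite -(dnorm_eq0 inner); apply/eqP; apply: (psumr_eq0P _ u0).
Qed.

HB.instance Definition _ := isDotProduct.Build C V hsum_inner hsum_inner_gt0.

Let hsum_norm (x : V) : C := sqrtC (hsum_inner x x).

Let hsum_normZ (l : C) (x : V) : hsum_norm (l *: x) = `|l| * hsum_norm x.
Proof.
rewrite /hsum_norm (dnormZ hsum_inner) sqrtCM ?nnegrE ?exprn_ge0 ?dnorm_ge0//.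
by rewrite sqrCK.
Qed.

Let hsum_norm_eq0 (x : V) : hsum_norm x = 0 -> x = 0.
Proof. by move/eqP; rewrite sqrt_dnorm_eq0 => /eqP. Qed.

HB.instance Definition _ := Lmodule_isNormed.Build C V
  (dot_ler_normD hsum_inner) hsum_normZ hsum_norm_eq0.

Lemma hsum_normE (x : V) : `|x| ^+ 2 = \sum_i `|x i| ^+ 2.
Proof.
rewrite [LHS]sqrtCK; apply: eq_bigr => i _.
by rewrite inner_norm.
Qed.

Lemma hsum_norm_coord (x : V) i : `|x i| <= `|x|.
Proof.
rewrite -(@ler_pXn2r _ 2)// ?nnegrE// hsum_normE (bigD1 i)//= lerDl.
by apply: sumr_ge0 => j _; rewrite exprn_ge0.
Qed.

Lemma hsum_norm_le (x : V) : `|x| <= \sum_i `|x i|.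
Proof.
rewrite -(@ler_pXn2r _ 2)// ?nnegrE ?sumr_ge0// hsum_normE.
rewrite expr2 mulr_suml; apply: ler_sum => i _.
rewrite expr2 ler_wpM2l// (bigD1 i)//= lerDl.
by apply: sumr_ge0.
Qed.

Let hsum_complete (F : set_system V) : ProperFilter F -> cauchy F -> cvg F.
Proof.
move=> FF /cauchy_ballP Fc; apply/cvg_ex.
have Fi i : cvg ((fun x : V => x i) @ F).
  apply: cauchy_cvg; apply/cauchy_ballP => e e0.
  have [[A B] [/= FA FB] AB] := Fc _ e0.
  exists ((fun x : V => x i) @` A, (fun x : V => x i) @` B).
    by split => /=; [apply: filterS FA|apply: filterS FB] => x Ax; exists x.
  move=> [_ _] [/= [x Ax <-] [y By <-]].
  have := AB (x, y) (conj Ax By); rewrite /= -!ball_normE/=.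
  apply: le_lt_trans; have := hsum_norm_coord (x - y) i.
  by rewrite !ffunE.
exists [ffun i => lim ((fun x : V => x i) @ F)].
apply/cvgrPdist_lt => e e0.
have en : 0 < e / n.+1%:R by rewrite divr_gt0.
have : F [set x : V | forall i,
    `|lim ((fun x : V => x i) @ F) - x i| < e / n.+1%:R].
  apply: filter_forall => i.
  by have /cvgrPdist_lt/(_ _ en) := Fi i.
apply: filterS => x xF; apply: le_lt_trans (hsum_norm_le _) _.
apply: (@le_lt_trans _ _ (\sum_(i < n) e / n.+1%:R)).
  by apply: ler_sum => i _; rewrite !ffunE ltW.
rewrite sumr_const card_ord -mulrnAl -[X in _ < X](@mulfK _ n.+1%:R)//.
by rewrite ltr_pM2r ?invr_gt0// -mulr_natr ltr_pM2l// ltr_nat.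
Qed.

HB.instance Definition _ := Uniform_isComplete.Build V hsum_complete.

Let hsum_inner_norm (x : V) : hsum_inner x x = `|x| ^+ 2.
Proof. by rewrite hsum_normE; apply: eq_bigr => i _; rewrite inner_norm. Qed.

HB.instance Definition _ := isHilbert.Build R V hsum_inner_norm.

Lemma hsum_innerE (x y : V) : <<x, y>> = \sum_i <<x i, y i>>.
Proof. by []. Qed.

End HilbertSum.

Section BoundedOperators.
Variables (R : realType) (H : hilbertType R).

Definition is_bop : {pred H -> H} := mem [set f | linear f /\ continuous f].

(* B(H): on normed spaces, bounded and continuous linear maps coincide. *)
Record bop : Type := Bop { bop_fun :> H -> H; bop_subproof : bop_fun \in is_bop }.

HB.instance Definition _ := [isSub for bop_fun].
HB.instance Definition _ := [Choice of bop by <:].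

Lemma is_bop_submod_closed : submod_closed is_bop.
Proof.
split=> [|a f g /set_mem[flin fcont] /set_mem[glin gcont]]; apply/mem_set.
  by split=> [a x y|x]; [rewrite /= scaler0 addr0|exact: cvg_cst].
split=> [b x y|x].
  by rewrite !fctE flin glin !scalerDr !scalerA [a * b]mulrC addrACA.
apply: cvgD; last exact: gcont.
by apply: cvgZr; exact: fcont.
Qed.

HB.instance Definition _ :=
  GRing.isSubmodClosed.Build R[i] (H -> H) is_bop is_bop_submod_closed.
HB.instance Definition _ := [SubChoice_isSubLmodule of bop by <:].

Lemma bop_linear (T : bop) : linear T.
Proof. by have /set_mem[] := bop_subproof T. Qed.

Lemma bop_continuous (T : bop) : continuous T.
Proof. by have /set_mem[] := bop_subproof T. Qed.

HB.instance Definition _ (T : bop) :=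
  GRing.isLinear.Build R[i] H H *:%R T (bop_linear T).

Lemma bopP (S T : bop) : S =1 T -> S = T.
Proof. by move=> ST; apply/val_inj/funext. Qed.

Let bop1_subproof : idfun \in is_bop.
Proof. by apply/mem_set; split=> // x; exact: cvg_id. Qed.

Let bopM_subproof (S T : bop) : S \o T \in is_bop.
Proof.
apply/mem_set; split=> [a x y|x]; first by rewrite /= !linearP.
by apply: continuous_comp; exact: bop_continuous.
Qed.

Let bop1 := Bop bop1_subproof.
Let bopM S T := Bop (bopM_subproof S T).

Let bopMA : associative bopM. Proof. by move=> S T U; exact/bopP. Qed.
Let bop1M : left_id bop1 bopM. Proof. by move=> S; exact/bopP. Qed.
Let bopM1 : right_id bop1 bopM. Proof. by move=> S; exact/bopP. Qed.
Let bopMDl : left_distributive bopM +%R.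
Proof. by move=> S T U; exact/bopP. Qed.
Let bopMDr : right_distributive bopM +%R.
Proof. by move=> S T U; apply/bopP => x /=; rewrite linearD. Qed.

(* Only a pzRingType: 1 = 0 when H is the zero space. *)
HB.instance Definition _ :=
  GRing.Zmodule_isPzRing.Build bop bopMA bop1M bopM1 bopMDl bopMDr.

Lemma bopDE (S T : bop) x : (S + T) x = S x + T x. Proof. by []. Qed.
Lemma bop0E x : (0 : bop) x = 0. Proof. by []. Qed.
Lemma bop1E x : (1 : bop) x = x. Proof. by []. Qed.
Lemma bopME (S T : bop) x : (S * T) x = S (T x). Proof. by []. Qed.
Lemma bop_sumE (I : Type) (r : seq I) (P : pred I) (S : I -> bop) x :
  (\sum_(i <- r | P i) S i) x = \sum_(i <- r | P i) S i x.
Proof. by elim/big_rec2 : _ => // i y T _ <-. Qed.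

Lemma bop_bounded (T : bop) : exists2 r : R[i], 0 < r & forall x, `|T x| <= r * `|x|.
Proof.
have /linear_bounded_continuous/linear_boundedP/pinfty_ex_gt0 := @bop_continuous T.
by move=> [r r0 Tr]; exists r.
Qed.

Lemma is_bopP (f : H -> H) (r : R[i]) : linear f -> 0 <= r ->
  (forall x, `|f x| <= r * `|x|) -> f \in is_bop.
Proof.
move=> flin r0 fr; apply/mem_set; split=> //.
pose g := GRing.isLinear.Build R[i] H H *:%R f flin.
pose F : {linear H -> H} := HB.pack f g.
apply: (@bounded_linear_continuous _ _ _ F).
apply/linear_boundedP; near=> s => x.
apply: le_trans (fr x) _; rewrite ler_wpM2r//; near: s.
exact/nbhs_pinfty_ge/ger0_real.
Unshelve. all: by end_near. Qed.

End BoundedOperators.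

Section Riesz.
Variables (R : realType) (H : hilbertType R).
Local Notation C := R[i].
Implicit Types x y z : H.

Lemma inner_CauchySchwarz x y : `|<<x, y>>| <= `|x| * `|y|.
Proof.
rewrite -(@ler_pXn2r _ 2)// ?nnegrE// ?mulr_ge0//.
by rewrite exprMn -!inner_norm dot_CauchySchwarz.
Qed.

Lemma inner_inj x y : (forall z, <<z, x>> = <<z, y>>) -> x = y.
Proof.
move=> xy; apply/eqP; rewrite -subr_eq0 -(dnorm_eq0 inner).
by rewrite linearBr subr_eq0; apply/eqP; exact: xy.
Qed.

Let arbitrarily_small (a b : C) : 0 <= a -> 0 <= b ->
  (forall e, 0 < e -> a <= e * b) -> a = 0.
Proof.
move=> a0 b0 ab; apply/eqP/negPn/negP => an0.
have {an0} a0' : 0 < a by rewrite lt0r an0.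
have b1 : 0 < b + 1 by rewrite ltr_wpDl.
have /ab : 0 < a / (b + 1) by rewrite divr_gt0.
rewrite mulrAC ler_pdivlMr// ler_pM2l//.
by rewrite gerDl ler10.
Qed.

(* Riesz representation: minimize the norm on the hyperplane [f x = 1]. *)
Lemma riesz (f : H -> C) (r : C) : scalar f -> 0 <= r ->
  (forall x, `|f x| <= r * `|x|) -> exists v, forall x, f x = <<x, v>>.
Proof.
move=> flin r0 fr.
pose g := GRing.isLinear.Build C H C *%R f flin.
pose f' : {scalar H} := HB.pack f g.
have fB x y : f (x - y) = f x - f y by exact: (raddfB f').
have fZ a x : f (a *: x) = a * f x by exact: (linearZ_LR f').
have [f0|/existsNP[x0 /eqP fx0]] := pselect (forall x, f x = 0).
  by exists 0 => x; rewrite f0 linear0r.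
pose A := [set complex.Re <<x, x>> | x in [set x | f x = 1]].
have ReE x : (complex.Re <<x, x>>)%:C = <<x, x>>.
  by rewrite RRe_real// ger0_real// dnorm_ge0.
have infA : has_inf A.
  split.
    exists (complex.Re <<(f x0)^-1 *: x0, (f x0)^-1 *: x0>>).
    by exists ((f x0)^-1 *: x0) => //=; rewrite fZ mulVf.
  exists 0 => _ [x _ <-]; rewrite -lecR ReE; exact: dnorm_ge0.
pose S e := [set x | f x = 1 /\ <<x, x>> < (inf A)%:C + e ^+ 2].
have Sne e : 0 < e -> S e !=set0.
  move=> e0; have e2 : 0 < e ^+ 2 by rewrite exprn_gt0.
  have e2E : (complex.Re (e ^+ 2))%:C = e ^+ 2 by rewrite RRe_real// gtr0_real.
  have /inf_adherent/(_ infA)[_ [x /= fx <-]] : 0 < complex.Re (e ^+ 2).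
    by rewrite -ltcR e2E.
  by rewrite -ltcR rmorphD/= e2E ReE => xe; exists x.
have Sperp e x z : 0 < e -> S e x -> f z = 0 -> `|<<x, z>>| <= e * `|z|.
  move=> e0 [fx xe] fz; have [->|z0] := eqVneq z 0.
    by rewrite linear0r !normr0 mulr0.
  have z2 : 0 < <<z, z>> by rewrite dnorm_gt0.
  rewrite -(@ler_pXn2r _ 2)// ?nnegrE// ?mulr_ge0// ?(ltW e0)//.
  rewrite exprMn -inner_norm -ler_pdivrMr//.
  have : (inf A)%:C <= <<x, x>> - `|<<x, z>>| ^+ 2 / <<z, z>>.
    rewrite -(dot_proj inner)// -ReE lecR; apply: ge_inf; first by case: infA.
    by exists (x - (<<x, z>> / <<z, z>>) *: z) => //=; rewrite fB fZ fz mulr0 subr0.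
  rewrite lerBrDr -lerBrDl => /le_trans; apply.
  by rewrite lerBlDl ltW.
pose F := filter_from [set e : C | 0 < e] S.
have FF : ProperFilter F.
  apply: filter_from_proper; last by move=> e /= e0; exact: Sne.
  apply: filter_from_filter; first by exists 1 => /=.
  move=> d e /= d0 e0.
  have de : 0 < d * e / (d + e) by rewrite divr_gt0 ?mulr_gt0 ?addr_gt0.
  have small (a b : C) : 0 < a -> 0 < b -> a * b / (a + b) <= a.
    move=> a0 b0; rewrite ler_pdivrMr ?addr_gt0// ler_pM2l// lerDr.
    exact: ltW.
  exists (d * e / (d + e)) => //= x [fx xde].
  have Sle a : 0 < a -> d * e / (d + e) <= a -> S a x.
    move=> a0 dea; split=> //; apply: lt_le_trans xde _; rewrite lerD2l.
    by rewrite ler_pXn2r// nnegrE ltW.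
  split; apply: Sle => //; first exact: small.
  by rewrite [d + e]addrC [d * e]mulrC; exact: small.
have : cvg F.
  apply: cauchy_cvg; apply/cauchy_ballP => e e0.
  have e3 : 0 < e / 3 by rewrite divr_gt0.
  exists (S (e / 3), S (e / 3)); first by split; exists (e / 3).
  move=> [x y] [/= Sx Sy]; rewrite -ball_normE/=.
  have fxy : f (x - y) = 0 by rewrite fB Sx.1 Sy.1 subrr.
  have [->|xy0] := eqVneq (x - y) 0; first by rewrite normr0.
  have xy_gt0 : 0 < `|x - y| by rewrite normr_gt0.
  have : `|x - y| <= e / 3 + e / 3.
    rewrite -(ler_pM2r xy_gt0) -expr2 -inner_norm mulrDl.
    have -> : <<x - y, x - y>> = `|<<x - y, x - y>>|.
      by rewrite ger0_norm// dnorm_ge0.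
    rewrite linearBl; apply: le_trans (ler_normB _ _) _.
    by apply: lerD; apply: Sperp.
  move=> /le_lt_trans; apply.
  rewrite -mulrDl ltr_pdivrMr// -mulr2n -[e *+ 2]mulr_natr ltr_pM2l//.
  by rewrite ltr_nat.
move=> /cvg_ex[l Fcl].
have Fl e : 0 < e -> F [set x | `|l - x| < e].
  exact: (iffLR (fcvgrPdist_lt _) Fcl).
have near_l e : 0 < e -> exists2 x, S e x & `|l - x| < e.
  move=> e0; have FS : F (S e) by exists e.
  have [x [Sx lx]] := filter_ex (filterI FS (Fl e e0)).
  by exists x.
have fl : f l = 1.
  apply/eqP; rewrite -subr_eq0 -normr_eq0; apply/eqP.
  apply: (@arbitrarily_small _ r) => // e e0.
  have [x [fx _] lx] := near_l e e0.
  rewrite -fx -fB; apply: le_trans (fr _) _.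
  by rewrite mulrC ler_wpM2r// ltW.
have l_perp z : f z = 0 -> <<l, z>> = 0.
  move=> fz; apply/eqP; rewrite -normr_eq0; apply/eqP.
  apply: (@arbitrarily_small _ (`|z| + `|z|)) => //.
  move=> e e0; have [x Sx lx] := near_l e e0.
  rewrite -(subrK x l) linearDl mulrDr; apply: le_trans (ler_normD _ _) _.
  apply: lerD; last exact: Sperp.
  apply: le_trans (inner_CauchySchwarz _ _) _.
  by rewrite ler_wpM2r// ltW.
have l0 : l != 0.
  apply/eqP => l0; move: fl; rewrite l0 -(subrr (0 : H)) fB subrr.
  by move/eqP; rewrite eq_sym oner_eq0.
have ll0 : 0 < <<l, l>> by rewrite dnorm_gt0.
exists (<<l, l>>^-1 *: l) => x.
have : <<x - f x *: l, l>> = 0.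
  by rewrite dot_conj l_perp ?rmorph0// fB fZ fl mulr1 subrr.
rewrite linearBl linearZl_LR/= => /eqP; rewrite subr_eq0 => /eqP xl.
rewrite linearZr_LR/= xl fmorphV/=.
have -> : (<<l, l>>)^*%R = <<l, l>> by apply/CrealP/ger0_real/ltW.
by rewrite mulrCA mulVf ?mulr1// gt_eqF.
Qed.

End Riesz.

Section Adjoint.
Variables (R : realType) (H : hilbertType R).
Implicit Types S T : bop H.

Definition is_adjoint T S := forall x y, <<T x, y>> = <<x, S y>>.

Lemma adjoint_uniq T S S' : is_adjoint T S -> is_adjoint T S' -> S = S'.
Proof. by move=> TS TS'; apply/bopP => y; apply: inner_inj => z; rewrite -TS TS'. Qed.

Lemma adjoint_exists T : exists S, is_adjoint T S.
Proof.
have [r r0 Tr] := bop_bounded T.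
have /choice[f fE] : forall y, exists v, forall x, <<T x, y>> = <<x, v>>.
  move=> y; apply: (@riesz _ _ _ (r * `|y|)).
  - by move=> a u v; rewrite linearP linearPl.
  - by rewrite mulr_ge0// ltW.
  - move=> x; apply: le_trans (inner_CauchySchwarz _ _) _.
    by rewrite mulrAC ler_wpM2r.
have flin : linear f.
  move=> a u v; apply: inner_inj => x.
  by rewrite -fE !linearPr/= !fE.
have fr x : `|f x| <= r * `|x|.
  have [->|fx0] := eqVneq (f x) 0; first by rewrite normr0 mulr_ge0// ltW.
  have fx_gt0 : 0 < `|f x| by rewrite normr_gt0.
  rewrite -(ler_pM2r fx_gt0) -expr2 -inner_norm -fE.
  rewrite -[X in X <= _]ger0_norm; last by rewrite fE dnorm_ge0.
  apply: le_trans (inner_CauchySchwarz _ _) _.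
  by rewrite mulrAC ler_wpM2r.
by exists (Bop (is_bopP flin (ltW r0) fr)) => x y; rewrite fE.
Qed.

Definition adjoint T : bop H := xget 0 (is_adjoint T).

Lemma adjointP T : is_adjoint T (adjoint T).
Proof. by have [S TS] := adjoint_exists T; apply: (@xgetPex _ 0 (is_adjoint T)); exists S. Qed.

End Adjoint.

Section Operators.
Variables (R : realType) (H : hilbertType R).
Implicit Types S T : bop H.

(* In R[i], [0 <= z] means that z is real and nonnegative. *)
Definition positive_op T := forall x, 0 <= <<T x, x>>.

Definition invertible_op T := exists S, S * T = 1 /\ T * S = 1.

Definition unitary_op T := adjoint T * T = 1 /\ T * adjoint T = 1.

(* Valued in \bar R; it is -oo when H is the zero space, which has no unit
   vectors. *)
Definition numradius T : \bar R :=
  ereal_sup [set (complex.Re `|<<T x, x>>|)%:E | x in [set x : H | `|x| = 1]].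

End Operators.

Section TensorProduct.
Variables (R : realType) (H K L : hilbertType R).

(* L, with x ⊗ y := t x y, is the Hilbert tensor product of H and K.  This
   determines L and t up to a unitary that respects simple tensors. *)
Definition is_hilbert_tensor (t : {bilinear H -> K -> L}) : Prop :=
  (forall x x' y y', <<t x y, t x' y'>> = <<x, x'>> * <<y, y'>>) /\
  dense [set z | exists (k : nat) (x : 'I_k -> H) (y : 'I_k -> K),
                   z = \sum_(i < k) t (x i) (y i)].

(* Z = X ⊗ U; Z is determined by its values on simple tensors, because they
   span a dense subspace. *)
Definition is_tensor_op (t : {bilinear H -> K -> L})
    (X : bop H) (U : bop K) (Z : bop L) : Prop :=
  forall x y, Z (t x y) = t (X x) (U y).

End TensorProduct.

(* All models L of the Hilbert tensor product of H and K give the same value of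
   numradius (X_1 ⊗ U_1 + ... + X_m ⊗ U_m), so letting L range over them does
   not change the supremum over K and U. *)
Definition joint_numradius (R : realType) (H : hilbertType R) (m : nat)
    (X : 'I_m -> bop H) : \bar R :=
  ereal_sup [set r | exists (K L : hilbertType R) (t : {bilinear H -> K -> L})
      (U : 'I_m -> bop K) (Z : 'I_m -> bop L),
    [/\ is_hilbert_tensor t,
        forall i, unitary_op (U i),
        forall i, is_tensor_op t (X i) (U i) (Z i) &
        r = numradius (\sum_i Z i)]].

Section OperatorMatrix.
Variables (R : realType) (H : hilbertType R) (n : nat).

Definition mx_fun (M : 'M[bop H]_n) (x : hsum H n) : hsum H n :=
  [ffun i => \sum_j M i j (x j)].

Lemma mx_fun_is_bop (M : 'M[bop H]_n) : mx_fun M \in @is_bop R (hsum H n).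
Proof.
have /choice[r rM] : forall p : 'I_n * 'I_n, exists r : R[i],
    0 < r /\ forall x, `|M p.1 p.2 x| <= r * `|x|.
  by move=> p; have [r r0 rM] := bop_bounded (M p.1 p.2); exists r.
apply: (@is_bopP _ _ _ (\sum_i \sum_j r (i, j))).
- move=> a x y; apply/ffunP => i; rewrite !ffunE scaler_sumr -big_split/=.
  by apply: eq_bigr => j _; rewrite !ffunE linearP.
- apply: sumr_ge0 => i _; apply: sumr_ge0 => j _.
  by have [/ltW] := rM (i, j).
- move=> x; apply: le_trans (hsum_norm_le _) _.
  rewrite mulr_suml; apply: ler_sum => i _; rewrite !ffunE mulr_suml.
  apply: le_trans (ler_norm_sum _ _ _) _; apply: ler_sum => j _.
  have [r0 rx] := rM (i, j); apply: le_trans (rx _) _.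
  by apply: ler_wpM2l; [exact: ltW|exact: hsum_norm_coord].
Qed.

(* The identification M_n(B(H)) = B(H^(n)). *)
Definition mx_op (M : 'M[bop H]_n) : bop (hsum H n) := Bop (mx_fun_is_bop M).

(* Indices start at 0: X k stands at (k, k + 1) and its adjoint at (k + 1, k). *)
Definition tridiag_mx (A : 'I_n -> bop H) (X : 'I_n.-1 -> bop H) :
    'M[bop H]_n :=
  \matrix_(i, j)
    if i == j then A i
    else if j == i.+1 :> nat then oapp X 0 (insub (val i))
    else if i == j.+1 :> nat then oapp (fun k => adjoint (X k)) 0 (insub (val j))
    else 0.

Lemma tridiag_mxE_sup A X (i j : 'I_n) (k : 'I_n.-1) :
  i = k :> nat -> j = k.+1 :> nat -> tridiag_mx A X i j = X k.
Proof.
move=> ik jk; rewrite mxE -val_eqE/= ik jk eqxx.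
by rewrite (ltn_eqF (ltnSn k)) valK.
Qed.

Lemma tridiag_mxE_sub A X (i j : 'I_n) (k : 'I_n.-1) :
  i = k.+1 :> nat -> j = k :> nat -> tridiag_mx A X i j = adjoint (X k).
Proof.
move=> ik jk; rewrite mxE -val_eqE/= ik jk eqxx.
by rewrite (gtn_eqF (ltnSn k)) (ltn_eqF (leqW (ltnSn k))) valK.
Qed.

End OperatorMatrix.

(* Main.v *)
From HB Require Import structures.
From mathcomp Require Import all_boot all_order all_algebra.
From mathcomp Require Import complex ring lra.
From mathcomp Require Import boolp classical_sets functions reals ereal.
From mathcomp Require Import topology normedtype.
Require Import Defs.

Set Implicit Arguments.
Unset Strict Implicit.
Unset Printing Implicit Defensive.

Import Order.TTheory GRing.Theory Num.Theory.
Import numFieldNormedType.Exports.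

Local Open Scope classical_set_scope.
Local Open Scope ring_scope.
Local Open Scope complex_scope.
Local Open Scope sesquilinear_scope.

(** Let [T] be the tridiagonal matrix with diagonal [A] and off-diagonal [X].

    If [T >= e > 0], let [z] be a vector of a tensor product and let [U k] be
    unitaries.  Evaluate the positive form of [T (x) 1] at the vector with
    slots [W k z], where [W 0 = 1] and [W (k + 1) = W k l U k] for a phase [l].
    As the [W k] are unitary, the diagonal contributes [|z|^2], because the
    [A k] have sum [1], while the entry [X k] contributes
    [l <(X k (x) U k) z, z>], because [(W k)^* W (k + 1) = l U k].  With
    [q = <(\sum_k X k (x) U k) z, z>] and the phase that makes [l q] negative,
    this says [|z|^2 - 2 |q| >= n e |z|^2]: the joint numerical radius is at most
    [(1 - n e) / 2].  For a finite sum [z] of simple tensors no operator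
    [T (x) 1] is needed: positivity of [T (x) 1] there is the positivity of
    the entrywise product of two positive kernels ([positive_schur_sum]), and
    the bound then extends by density ([joint_numradius_lt_half]).

    Conversely, let the joint numerical radius be at most [w < 1/2].  Look for
    the [A k] as one linear form [f] on families, indexed by the slots, of
    finite rank forms, [f] being the sum of the pairings with the [A k].  Then
    [\sum_k A k <= 2 w] and [T >= 0] are inequalities [f x <= r] for [(x, r)] in
    a convex cone, and a Hahn-Banach argument for cones ([cone_extension])
    gives [f] as soon as the cone contains no [(0, r)] with [r < 0].  An
    element [(0, r)] of the cone is a positive finite rank [n x n] block
    operator whose diagonal blocks are all equal.  Two finite families of
    vectors with the same sum of rank one operators are unitary transforms of
    each other ([unitarily_equivalent_families]), so the slots of this operator
    have the form [W k z] for a vector [z] of [H] (x) [C^N] and unitary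
    matrices [W k], as above.  Hence
    [r = 2 w |z|^2 + 2 Re <(\sum_k X k (x) (W k)^* W (k + 1)) z, z>], and this
    is nonnegative by definition of the joint numerical radius
    ([requirement_nonneg]).  The values of [f] are turned into operators by
    Riesz representation ([form_operator]).  Since [2 w < 1], the operator
    [1 - \sum_k A k] is bounded below by a positive constant; adding to each
    [A k] an equal share of it makes the [A k] have sum [1], and makes them
    and [T] strictly positive, hence invertible ([coercive_invertible]). *)

(** * Matrices with the same Gram matrix *)

Section UnitaryFreedom.
Variable C : numClosedFieldType.

Lemma trmxC_mul m n p (A : 'M[C]_(m, n)) (B : 'M[C]_(n, p)) :
  (A *m B) ^t* = B ^t* *m A ^t*.
Proof. by rewrite trmx_mul map_mxM. Qed.

Lemma mulmx_trmxC_eq0 m n (A : 'M[C]_(m, n)) : A *m A ^t* = 0 -> A = 0.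
Proof.
move=> A0; apply/matrixP => i j; rewrite [RHS]mxE.
have : (A *m A ^t*) i i = 0 by rewrite A0 mxE.
rewrite mxE => /psumr_eq0P Ai0; apply/eqP.
rewrite -mul_conjC_eq0; have := Ai0 _ j isT; rewrite !mxE => ->//.
by move=> k _; rewrite !mxE mul_conjC_ge0.
Qed.

Lemma unitarymx_complete r s (Q : 'M[C]_(r, r + s)) : Q \is unitarymx ->
  exists Q' : 'M[C]_(s, r + s), col_mx Q Q' \is unitarymx.
Proof.
move=> Qu; have rK : \rank (kermx (Q ^t*)) = s.
  by rewrite mxrank_ker mxrank_map mxrank_tr mxrank_unitary// addKn.
have [Q' Q'u Q'Q] : exists2 Q' : 'M[C]_(s, r + s),
    Q' \is unitarymx & Q' *m Q ^t* = 0.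
  suff complK k : \rank (kermx (Q ^t*)) = k -> exists2 Q' : 'M[C]_(k, r + s),
    Q' \is unitarymx & Q' *m Q ^t* = 0 by exact: complK rK.
  case: _ /; exists (schmidt (row_base (kermx (Q ^t*)))).
    exact/schmidt_unitarymx/rank_leq_col.
  apply/sub_kermxP.
  by rewrite eqmx_schmidt_free ?row_base_free// eq_row_base.
exists Q'; apply/unitarymxP; rewrite tr_col_mx map_row_mx mul_col_row.
rewrite (unitarymxP Qu) (unitarymxP Q'u) Q'Q.
have -> : Q *m Q' ^t* = 0.
  by rewrite -[Q]trmxCK -trmxC_mul Q'Q trmx0 map_mx0.
by rewrite -scalar_mx_block.
Qed.

(** In an orthonormal basis of the common row space of [M1] the matrix [M1]
    becomes a matrix [B] of coordinates.  The same row operations applied to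
    [M2] give an orthonormal family too, and [M2] has the same coordinates in
    it, because both facts only depend on the Gram matrix.  The unitary sends
    one orthonormal family to the other. *)
Lemma gram_unitary m N (M1 M2 : 'M[C]_(m, N)) :
  M1 *m M1 ^t* = M2 *m M2 ^t* ->
  exists2 U : 'M[C]_N, U \is unitarymx & M2 = M1 *m U.
Proof.
move=> M12.
have gramS k (S : 'M[C]_(k, m)) :
    (S *m M1) *m (S *m M1) ^t* = (S *m M2) *m (S *m M2) ^t*.
  by rewrite !trmxC_mul !mulmxA -(mulmxA S) M12 mulmxA.
have [r [B [S [rN Pu MB]]]] : exists r (B : 'M[C]_(m, r)) (S : 'M[C]_(r, m)),
    [/\ (r <= N)%N, S *m M1 \is unitarymx & M1 = B *m (S *m M1)].
  pose P := schmidt (row_base M1).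
  have PM : (P :=: M1)%MS.
    by apply: eqmx_trans (eq_row_base M1); exact/eqmx_schmidt_free/row_base_free.
  have /submxP[S PE] : (P <= M1)%MS by rewrite PM.
  have /submxP[B MB] : (M1 <= P)%MS by rewrite PM.
  exists (\rank M1), B, S; rewrite -PE; split=> //; first exact: rank_leq_col.
  exact/schmidt_unitarymx/rank_leq_col.
have Qu : S *m M2 \is unitarymx.
  by apply/unitarymxP; rewrite -gramS; exact/unitarymxP.
have M2B : M2 = B *m (S *m M2).
  apply/eqP; rewrite -subr_eq0 mulmxA -[X in X - _]mul1mx -mulmxBl; apply/eqP.
  apply: mulmx_trmxC_eq0; rewrite -gramS mulmxBl mul1mx -mulmxA -MB subrr.
  by rewrite mul0mx.
move: (S *m M1) (S *m M2) => P Q in Pu MB Qu M2B *.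
have [s Ns] : exists s, N = (r + s)%N by exists (N - r)%N; rewrite subnKC.
subst N; have [P' P'u] := unitarymx_complete Pu.
have [Q' Q'u] := unitarymx_complete Qu.
exists ((col_mx P P') ^t* *m col_mx Q Q').
  by rewrite mul_unitarymx// trmxC_unitary.
rewrite MB M2B tr_col_mx map_row_mx !mulmxA mul_mx_row -!mulmxA (unitarymxP Pu).
have -> : P *m P' ^t* = 0.
  move/unitarymxP: P'u; rewrite tr_col_mx map_row_mx mul_col_row.
  by rewrite scalar_mx_block => /eq_block_mx[].
by rewrite mulmx1 mulmx0 mul_row_col mul0mx addr0.
Qed.
End UnitaryFreedom.

(** Pairing with finitely many test vectors turns the two families into
    matrices with the same Gram matrix.  The families themselves suffice as
    test vectors, because [v i] and its candidate value lie in their span. *)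
Lemma unitarily_equivalent_families (R : realType) (H : hilbertType R) N
    (a v : 'I_N -> H) :
  (forall x y, \sum_j <<x, a j>> * <<a j, y>> =
               \sum_j <<x, v j>> * <<v j, y>>) ->
  exists2 U : 'M[R[i]]_N, U \is unitarymx &
    forall i, v i = \sum_j (U i j) *: a j.
Proof.
move=> av.
pose y (l : 'I_(N + N)) :=
  match fintype.split l with inl j => a j | inr j => v j end.
pose M (u : 'I_N -> H) : 'M_(N + N, N) := \matrix_(l, j) <<y l, u j>>.
have gramE u : M u *m M u ^t* = \matrix_(k, l) \sum_j <<y k, u j>> * <<u j, y l>>.
  apply/matrixP => k l; rewrite !mxE; apply: eq_bigr => j _.
  by rewrite !mxE -dot_conj.
have /gram_unitary[U Uu MU] : M a *m M a ^t* = M v *m M v ^t*.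
  by rewrite !gramE; apply/matrixP => k l; rewrite !mxE av.
exists (U ^t*); first by rewrite trmxC_unitary.
move=> i; pose z := v i - \sum_j (U ^t*) i j *: a j.
have yz l : <<y l, z>> = 0.
  rewrite linearBr/= linear_sumr/=; apply/eqP; rewrite subr_eq0.
  move/matrixP/(_ l i) : MU; rewrite !mxE => ->; apply/eqP.
  by apply: eq_bigr => j _; rewrite !mxE linearZr_LR/= conjCK mulrC.
have ya j : a j = y (lshift N j) by rewrite /y (unsplitK (inl j)).
have yv j : v j = y (rshift N j) by rewrite /y (unsplitK (inr j)).
apply/eqP; rewrite -subr_eq0 -(dnorm_eq0 inner) -/z {1}/z linearBl/=.
rewrite yv yz linear_sumlz big1 ?subrr//= => j _.
by rewrite linearZl_LR/= ya yz mulr0.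
Qed.

(** * Hahn-Banach extension for convex cones *)

Section ConeExtension.
Variables (R : realType) (V : lmodType R).
Implicit Types P : V -> R -> Prop.

Definition pos_cone P :=
  (forall x y r s, P x r -> P y s -> P (x + y) (r + s)) /\
  (forall a x r, 0 < a -> P x r -> P (a *: x) (a * r)).

(** [P x r] stands for the requirement [f x <= r] on an unknown linear form [f].
    By the last condition, [f x] is bounded on both sides or on none, so that a
    value for it can be chosen in either case. *)
Definition consistent P :=
  [/\ P 0 0, pos_cone P, forall r, P 0 r -> 0 <= r &
      forall x r, P x r -> exists s, P (- x) s].

Definition add_line P t c (x : V) (r : R) :=
  exists y s a, [/\ P y s, x = y + a *: t & r = s + a * c].

(** Consistency puts the upper bounds for [f t] above the lower bounds. *)
Lemma consistent_value P t : consistent P -> exists c,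
  (forall r, P t r -> c <= r) /\ (forall r, P (- t) r -> - c <= r).
Proof.
case=> P0 [PD _] Ppos Psym; have [[r0 tr0]|nt] := pselect (exists r, P t r).
  have [s0 ts0] := Psym _ _ tr0.
  have lbt s : P (- t) s -> lbound [set r | P t r] (- s).
    by move=> ts r /= tr; rewrite -subr_ge0 opprK Ppos// -(subrr t); exact: PD.
  exists (inf [set r | P t r]); split=> r.
    by move=> tr; apply: ge_inf => //; exists (- s0); exact: lbt.
  move=> tr; rewrite lerNl; apply: lb_le_inf; first by exists r0.
  exact: lbt.
exists 0; split=> r tr; first by case: nt; exists r.
by case: nt; have [s] := Psym _ _ tr; rewrite opprK => ts; exists s.
Qed.

Lemma consistent_add_line P t : consistent P ->
  exists c, consistent (add_line P t c).
Proof.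
move=> Pc; have [c [ct cNt]] := consistent_value t Pc; exists c.
case: Pc => P0 [PD PZ] Ppos Psym; split.
- by exists 0, 0, 0; rewrite scale0r mul0r !addr0.
- split=> [_ _ _ _ [y [s [a [ys -> ->]]]] [y' [s' [a' [ys' -> ->]]]]|].
    exists (y + y'), (s + s'), (a + a'); split; first exact: PD.
      by rewrite scalerDl addrACA.
    by rewrite mulrDl addrACA.
  move=> b _ _ b0 [y [s [a [ys -> ->]]]].
  exists (b *: y), (b * s), (b * a); split; first exact: PZ.
    by rewrite scalerDr scalerA.
  by rewrite mulrDr mulrA.
- move=> _ [y [s [a [ys /eqP + ->]]]].
  rewrite eq_sym addr_eq0 => /eqP yE.
  have [a0|a0|a0] := ltrgtP a 0.
  + have Na : 0 < - a by rewrite oppr_gt0.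
    have /ct : P t ((- a)^-1 * s).
      suff -> : t = (- a)^-1 *: y by apply: PZ => //; rewrite invr_gt0.
      by rewrite yE -scaleNr scalerA mulVf ?scale1r// gt_eqF.
    by rewrite mulrC ler_pdivlMr// mulrN mulrC -subr_ge0 opprK.
  + have /cNt : P (- t) (a^-1 * s).
      suff -> : - t = a^-1 *: y by apply: PZ => //; rewrite invr_gt0.
      by rewrite yE scalerN scalerA mulVf ?scale1r// gt_eqF.
    by rewrite mulrC ler_pdivlMr// mulNr mulrC -subr_ge0 opprK.
  + rewrite a0 mul0r addr0; apply: Ppos.
    by move: ys; rewrite yE a0 scale0r oppr0.
- move=> _ _ [y [s [a [ys -> _]]]]; have [s' ys'] := Psym _ _ ys.
  exists (s' + (- a) * c), (- y), s', (- a); split=> //.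
  by rewrite opprD scaleNr.
Qed.

(** Zorn's lemma for the sets that are consistent together with [P], rather than
    for the consistent sets that contain [P], so that the empty chain needs no
    separate treatment. *)
Lemma consistent_maximal P : consistent P -> exists Q, [/\ consistent Q,
  (forall x r, P x r -> Q x r) &
  forall Q', consistent Q' -> (forall x r, Q x r -> Q' x r) ->
    forall x r, Q' x r -> Q x r].
Proof.
move=> Pc; pose ext (A : set (V * R)) x r := P x r \/ A (x, r).
have [F FA tot|A [Ac Amax]] := @Zorn_bigcup _ [set A | consistent (ext A)].
  pose G := \bigcup_(X in F) X.
  have common x r y s : ext G x r -> ext G y s -> exists A,
      [/\ consistent (ext A), ext A x r, ext A y s &
          forall z q, ext A z q -> ext G z q].
    have extF X : F X -> forall z q, ext X z q -> ext G z q.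
      by move=> FX z q [Pz|Xz]; [left|right; exists X].
    move=> [Px|[X FX Xx]] [Py|[Y FY Yy]].
    - exists set0; split; [|by left|by left|by move=> z q [|//]; left].
      suff -> : ext set0 = P by [].
      apply/funext => z; apply/funext => q; apply/propext.
      by split=> [[]|]//; left.
    - by exists Y; split; [exact: FA|left|right|exact: extF].
    - by exists X; split; [exact: FA|right|left|exact: extF].
    - have [XY|YX] := tot _ _ FX FY.
        by exists Y; split; [exact: FA|right; exact: XY|right|exact: extF].
      by exists X; split; [exact: FA|right|right; exact: YX|exact: extF].
  case: (Pc) => P0 _ _ _; split; first by left.
  - split=> [x y r s Gx Gy|a x r a0 Gx].
      have [A [[_ [AD _] _ _] Ax Ay AG]] := common _ _ _ _ Gx Gy.
      by apply/AG/AD.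
    have [A [[_ [_ AZ] _ _] Ax _ AG]] := common _ _ _ _ Gx Gx.
    by apply/AG/AZ.
  - move=> r Gr; have [A [[_ _ Apos _] Ar _ _]] := common _ _ _ _ Gr Gr.
    exact: Apos.
  - move=> x r Gx; have [A [[_ _ _ Asym] Ax _ AG]] := common _ _ _ _ Gx Gx.
    by have [s ?] := Asym _ _ Ax; exists s; exact: AG.
exists (ext A); split=> //; first by move=> x r; left.
move=> Q' Q'c AQ' x r Q'x; apply: contrapT => nAx.
pose B : set (V * R) := [set p | Q' p.1 p.2].
apply: (Amax B).
  split=> [p Ap|BA]; last by apply: nAx; right; exact: (BA (x, r)).
  by apply: AQ'; right; rewrite -surjective_pairing.
suff extB : ext B = Q' by rewrite /= extB.
apply/funext => z; apply/funext => q; apply/propext.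
split=> [[Pz|//]|]; last by right.
by apply: AQ'; left.
Qed.

(** The Hahn-Banach theorem for a cone of requirements: a maximal consistent
    extension decides the value of [f] at every point, since a line can be added
    at any point. *)
Theorem cone_extension P : consistent P -> exists f : V -> R,
  (forall a x y, f (a *: x + y) = a * f x + f y) /\
  (forall x r, P x r -> f x <= r).
Proof.
move=> /consistent_maximal[Q [Qc PQ Qmax]].
have /choice[f fQ] : forall t, exists c, Q t c /\ Q (- t) (- c).
  move=> t; have [c Lc] := consistent_add_line t Qc; exists c.
  case: (Qc) => Q0 _ _ _.
  split; apply: (Qmax _ Lc) => [x r Qx|].
  + by exists x, r, 0; rewrite scale0r mul0r !addr0.
  + by exists 0, 0, 1; rewrite scale1r mul1r !add0r.
  + by exists x, r, 0; rewrite scale0r mul0r !addr0.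
  + by exists 0, 0, (- 1); rewrite scaleN1r mulN1r !add0r.
case: Qc => Q0 [QD QZ] Qpos Qsym.
have fle x r : Q x r -> f x <= r.
  by move=> Qx; rewrite -subr_ge0 Qpos// -(subrr x); apply: QD; last exact: (fQ x).2.
have fE x r : Q x r -> Q (- x) (- r) -> f x = r.
  move=> Qx QNx; apply/eqP; rewrite eq_le fle//= -subr_ge0 Qpos//.
  by rewrite -(subrr x); apply: QD => //; exact: (fQ x).1.
have QZf a x : Q (a *: x) (a * f x).
  have [a0|a0|->] := ltrgtP a 0; last by rewrite scale0r mul0r.
    rewrite -[a]opprK scaleNr mulNr -scalerN -mulrN; apply: QZ (fQ x).2.
    by rewrite oppr_gt0.
  exact: QZ (fQ x).1.
exists f; split=> [a x y|x r /PQ]; last exact: fle.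
apply: fE; first by apply: QD (fQ y).1; exact: QZf.
by rewrite !opprD -scaleNr -mulNr; apply: QD (fQ y).2; exact: QZf.
Qed.

End ConeExtension.

(** * Bounded forms and operators *)

Section Forms.
Variables (R : realType) (H : hilbertType R).
Local Notation C := R[i].

(** For each [v], Riesz representation applies to [fun u => B u v]. *)
Lemma sesquilinear_operator (B : H -> H -> C) (r : C) : 0 <= r ->
  (forall a u v w, B (a *: u + v) w = a * B u w + B v w) ->
  (forall u v, B u v = (B v u)^*%R) ->
  (forall u v, `|B u v| <= r * `|u| * `|v|) ->
  exists A : bop H, forall u v, <<A u, v>> = B u v.
Proof.
move=> r0 Blin Bsym Br.
have /choice[A AE] : forall v, exists w, forall u, B u v = <<u, w>>.
  move=> v; apply: (@riesz _ _ _ (r * `|v|)).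
  - by move=> a u w; rewrite Blin.
  - by rewrite mulr_ge0.
  - by move=> u; rewrite mulrAC.
have Alin : linear A.
  move=> a u v; apply: inner_inj => x.
  by rewrite -AE linearPr/= -!AE Bsym Blin rmorphD rmorphM/= -!Bsym.
have AB x : `|A x| <= r * `|x|.
  have [->|Ax0] := eqVneq (A x) 0; first by rewrite normr0 mulr_ge0.
  rewrite -(@ler_pM2r _ `|A x|) ?normr_gt0// -expr2 -inner_norm -AE.
  apply: le_trans (real_ler_norm _) _; last by rewrite mulrAC.
  by rewrite AE ger0_real// dnorm_ge0.
by exists (Bop (is_bopP Alin r0 AB)) => u v; rewrite [LHS]dot_conj -AE -Bsym.
Qed.

Let normE (u : H) : (complex.Re `|u|)%:C = `|u|.
Proof. by rewrite RRe_real// ger0_real. Qed.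

Lemma form_bound (b : H -> H -> R) (c : R) :
  (forall a u v w, b (a%:C *: u + v) w = a * b u w + b v w) ->
  (forall u v, b u v = b v u) ->
  (forall u, 0 <= b u u) ->
  (forall u, (b u u)%:C <= c%:C * `|u| ^+ 2) ->
  forall u v, `|(b u v)%:C| <= c%:C * `|u| * `|v|.
Proof.
move=> blin bsym b0 bc u v.
have b0l z : b 0 z = 0.
  by have := blin (-1) 0 0 z; rewrite scaler0 addr0 mulN1r addNr.
have bZl a x z : b (a%:C *: x) z = a * b x z.
  by rewrite -[_ *: x]addr0 blin b0l addr0.
have bDl x y z : b (x + y) z = b x z + b y z.
  by have := blin 1 x y z; rewrite scale1r mul1r.
have bZr a x z : b x (a%:C *: z) = a * b x z by rewrite bsym bZl bsym.
have bDr x y z : b x (y + z) = b x y + b x z by rewrite !(bsym x) bDl.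
have [->|u0] := eqVneq u 0; first by rewrite b0l !normr0 mulr0 mul0r.
have [->|v0] := eqVneq v 0; first by rewrite bsym b0l !normr0 mulr0.
have bc' w : b w w <= c * complex.Re `|w| ^+ 2.
  by rewrite -lecR rmorphM rmorphXn/= normE.
have breal : (b u v)%:C \is Num.real by apply/complex_realP; exists (b u v).
rewrite real_ler_norml// -(normE u) -(normE v) -!rmorphM -rmorphN !lecR.
have p0 : 0 < complex.Re `|u| by rewrite -ltcR normE normr_gt0.
have q0 : 0 < complex.Re `|v| by rewrite -ltcR normE normr_gt0.
move: (bc' u) (bc' v) p0 q0; set p := complex.Re `|u|; set q := complex.Re `|v|.
move=> bu bv p0 q0.
(* The two vectors below are balanced so as to have the same norm [p * q]. *)
have key s : s ^+ 2 = 1 -> 0 <= (p * q) * (c * p * q + s * b u v).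
  move=> s1; have := b0 (q%:C *: u + (s * p)%:C *: v).
  rewrite bDl !bDr !bZl !bZr (bsym v u).
  have : q ^+ 2 * b u u <= q ^+ 2 * (c * p ^+ 2) by rewrite ler_wpM2l// sqr_ge0.
  have : p ^+ 2 * b v v <= p ^+ 2 * (c * q ^+ 2) by rewrite ler_wpM2l// sqr_ge0.
  have -> : s * p * (s * p * b v v) = s ^+ 2 * (p ^+ 2 * b v v) by ring.
  rewrite s1. lra.
have pq0 : 0 < p * q by rewrite mulr_gt0.
have := key 1; have := key (-1).
rewrite !pmulr_rge0// sqrrN expr1n mulN1r mul1r => /(_ erefl) k1 /(_ erefl) k2.
by rewrite lerNl -subr_ge0 opprK k2/= -subr_ge0.
Qed.

(** A positive bounded real quadratic form that is invariant under complex
    phases is the quadratic form of an operator: its polarization [b] becomes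
    sesquilinear once [- b ('i u) v] is taken as imaginary part. *)
Lemma form_operator (b : H -> H -> R) (c : R) : 0 <= c ->
  (forall a u v w, b (a%:C *: u + v) w = a * b u w + b v w) ->
  (forall u v, b u v = b v u) ->
  (forall u v, b ('i%C *: u) ('i%C *: v) = b u v) ->
  (forall u, 0 <= b u u) ->
  (forall u, (b u u)%:C <= c%:C * `|u| ^+ 2) ->
  exists A : bop H, forall u, <<A u, u>> = (b u u)%:C.
Proof.
move=> c0 blin bsym bi b0 bc.
have bii (u : H) : 'i%C *: ('i%C *: u) = - u.
  by rewrite scalerA (sqr_i R : _ * _ = _) scaleN1r.
have b0l z : b 0 z = 0.
  by have := blin (-1) 0 0 z; rewrite scaler0 addr0 mulN1r addNr.
have bZl a x z : b (a%:C *: x) z = a * b x z.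
  by rewrite -[_ *: x]addr0 blin b0l addr0.
have bDl x y z : b (x + y) z = b x z + b y z.
  by have := blin 1 x y z; rewrite scale1r mul1r.
have bNl x z : b (- x) z = - b x z.
  by apply/eqP; rewrite -addr_eq0 -bDl addNr b0l.
have bir (u v : H) : b u ('i%C *: v) = - b ('i%C *: u) v by rewrite -bi bii bsym bNl bsym.
have biu (u : H) : b ('i%C *: u) u = 0.
  have := bir u u; rewrite bsym => /eqP.
  by rewrite -addr_eq0 -mulr2n mulrn_eq0 => /eqP.
have bC x y (u w : H) : b ((x +i* y) *: u) w = x * b u w + y * b ('i%C *: u) w.
  have -> : (x +i* y) *: u = x%:C *: u + y%:C *: ('i%C *: u).
    by rewrite scalerA -scalerDl [x +i* y]complexE/= ['i%C * _]mulrC.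
  by rewrite bDl !bZl.
pose B u v := b u v +i* (- b ('i%C *: u) v).
have [||||A AE] := @sesquilinear_operator B (c%:C + c%:C).
- by rewrite addr_ge0// lecR.
- move=> [x y] u v w; rewrite /B scalerDr.
  have -> : 'i%C *: ((x +i* y) *: u) = (x +i* y) *: ('i%C *: u).
    by rewrite !scalerA mulrC.
  rewrite !bDl (bC x y u) (bC x y ('i%C *: u)) bii bNl.
  by apply/eqP; rewrite eq_complex/=; apply/andP; split; apply/eqP; ring.
- move=> u v; rewrite /B/= [b v u]bsym; apply/eqP; rewrite eq_complex/= eqxx/=.
  by rewrite opprK [b (_ *: v) _]bsym bir.
- have iu (u : H) : `|'i%C *: u| = `|u|.
    by rewrite normrZ (_ : `|'i%C| = 1) ?mul1r// complexiE normCi.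
  move=> u v; rewrite [B u v]complexE/=; apply: le_trans (ler_normD _ _) _.
  rewrite !mulrDl lerD//; first exact: form_bound.
  rewrite normrM complexiE normCi mul1r rmorphN normrN -[`|u|]iu.
  exact: form_bound.
by exists A => u; rewrite AE /B biu oppr0.
Qed.
End Forms.

(** * Strictly positive operators *)

Section StrictlyPositive.
Variables (R : realType) (H : hilbertType R).
Local Notation C := R[i].
Implicit Types T : bop H.

(** Polarization, with the sums [x + y] and [x + 'i y]. *)
Lemma positive_selfadjoint T x y : positive_op T -> <<T x, y>> = <<x, T y>>.
Proof.
move=> Tp; rewrite [RHS]dot_conj.
have Im0 z : complex.Im <<T z, z>> = 0 := ger0_Im (Tp z).
have := Im0 (x + y); have := Im0 (x + 'i%C *: y).
rewrite !linearD/= !linearDl/= [T (_ *: y)]linearZ/=.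
rewrite !linearZl_LR/= !linearZr_LR/=.
have := Im0 x; have := Im0 y.
case: <<T x, y>> => a b; case: <<T y, x>> => c d.
case: <<T x, x>> => a1 b1; case: <<T y, y>> => a2 b2 /=.
move=> -> -> h1 h2; apply/eqP; rewrite eq_complex/=.
by apply/andP; split; apply/eqP; lra.
Qed.

(** With [r] a bound for [T], positivity at [x - r^-1 T x] gives
    [|T x|^2 <= r <T x, x>], and [|x|] is at most a multiple of [|T x|]. *)
Lemma strictly_positive_lower T : positive_op T -> invertible_op T ->
  exists2 e : C, 0 < e & forall x, e * `|x| ^+ 2 <= <<T x, x>>.
Proof.
move=> Tp [S [ST _]]; have [r r0 Tr] := bop_bounded T.
have [s s0 Ss] := bop_bounded S.
have r'0 : 0 < r^-1 by rewrite invr_gt0.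
exists (r^-1 * s^-1 ^+ 2) => [|x].
  by rewrite mulr_gt0// exprn_gt0// invr_gt0.
have rr : (r^-1)^*%R = r^-1 by apply/CrealP/gtr0_real.
have xT : s^-1 * `|x| <= `|T x|.
  by rewrite ler_pdivrMl// -[x in leLHS]bop1E -ST bopME.
have TTx : <<T (T x), T x>> <= r * `|T x| ^+ 2.
  apply: le_trans (real_ler_norm (ger0_real (Tp _))) _.
  apply: le_trans (inner_CauchySchwarz _ _) _.
  by rewrite expr2 mulrA ler_wpM2r.
have := Tp (x - r^-1 *: T x).
rewrite [T (_ - _)]linearB/= [T (_ *: _)]linearZ/= linearBl/= !linearBr/=.
rewrite !linearZl_LR/= !linearZr_LR/= rr.
rewrite [<<T (T x), x>>]positive_selfadjoint// !inner_norm.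
move=> h; have h2 : r^-1 * `|T x| ^+ 2 <= <<T x, x>>.
  rewrite -subr_ge0; apply: le_trans h _.
  have : r^-1 * (r^-1 * <<T (T x), T x>>) <= r^-1 * (r^-1 * (r * `|T x| ^+ 2)).
    by rewrite !ler_pM2l.
  rewrite [r^-1 * (r * _)]mulrA mulVf ?mul1r ?gt_eqF// -subr_ge0 => h.
  rewrite -subr_ge0; apply: le_trans h _.
  by rewrite le_eqVlt; apply/orP; left; apply/eqP; ring.
apply: le_trans h2; rewrite -mulrA ler_pM2l// -exprMn.
by rewrite ler_pXn2r// nnegrE// mulr_ge0// invr_ge0 ltW.
Qed.

Section Coercive.
Variables (T : bop H) (e : C).
Hypotheses (e0 : 0 < e) (Te : forall x, e * `|x| ^+ 2 <= <<T x, x>>).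

Let T_ge0 x : 0 <= <<T x, x>>.
Proof. by apply: le_trans (Te x); rewrite mulr_ge0 ?exprn_ge0// ltW. Qed.

Lemma coercive_lower x : e * `|x| <= `|T x|.
Proof.
have [->|x0] := eqVneq x 0; first by rewrite normr0 mulr0.
have x_gt0 : 0 < `|x| by rewrite normr_gt0.
rewrite -(ler_pM2r x_gt0) -mulrA -expr2; apply: le_trans (Te x) _.
by apply: le_trans (inner_CauchySchwarz _ _); exact/real_ler_norm/ger0_real.
Qed.

(** Subtracting a small multiple of [T y] shortens [y] by a factor that does not
    depend on [y], as [T] is bounded and bounded below. *)
Let residual_step : exists2 q : R, 0 <= q < 1 &
  forall y : H, exists z, `|y - T z| ^+ 2 <= q%:C * `|y| ^+ 2.
Proof.
have [r r0 Tr] := bop_bounded T.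
(* [s] is a bound for [T] larger than [e], so that [k < 1]. *)
pose s := r + e.
have s0 : 0 < s by rewrite addr_gt0.
pose k := e / s.
have k0 : 0 < k by rewrite divr_gt0.
have k1 : k < 1 by rewrite ltr_pdivrMr// mul1r ltrDr.
pose q := 1 - k ^+ 2.
have q0 : 0 <= q by rewrite subr_ge0 expr_le1// ltW.
have qE : (complex.Re q)%:C = q by rewrite RRe_real// ger0_real.
exists (complex.Re q).
  by rewrite -lecR -ltcR qE q0/= ltrBlDr ltrDl exprn_gt0.
move=> y; exists ((e / s ^+ 2) *: y); rewrite qE -inner_norm.
rewrite linearZ/=; set l := e / s ^+ 2.
have l0 : 0 < l by rewrite divr_gt0// exprn_gt0.
have lr : l^*%R = l by apply/CrealP/gtr0_real.
rewrite linearBl !linearBr/= !linearZl_LR/= !linearZr_LR/= lr.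
rewrite [<<y, T y>>]dot_conj (CrealP (ger0_real (T_ge0 y))) !inner_norm.
have Ty : `|T y| ^+ 2 <= s ^+ 2 * `|y| ^+ 2.
  rewrite -exprMn ler_pXn2r ?nnegrE ?mulr_ge0// ?(ltW s0)//.
  by apply: le_trans (Tr y) _; rewrite ler_wpM2r// lerDl ltW.
have -> : q * `|y| ^+ 2 =
    `|y| ^+ 2 - l * (e * `|y| ^+ 2) -
    (l * (e * `|y| ^+ 2) - l * (l * (s ^+ 2 * `|y| ^+ 2))).
  by rewrite /q /l /k; field; exact: lt0r_neq0.
by apply: lerB; apply: lerB => //; rewrite !(ler_pM2l l0).
Qed.

(** The squared distance of [y] to the range of [T] is at most [q] times itself
    for some [q < 1]. *)
Let dense_range (y : H) (d : C) : 0 < d -> exists x, `|y - T x| < d.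
Proof.
move=> d0; have [q /andP[q0 q1] Tq] := residual_step.
pose A := [set complex.Re (`|y - T x| ^+ 2) | x in [set: H]].
have ReE x : (complex.Re (`|y - T x| ^+ 2))%:C = `|y - T x| ^+ 2.
  by rewrite RRe_real// ger0_real// exprn_ge0.
have Alb : lbound A 0.
  by move=> _ [x _ <-]; rewrite -lecR ReE exprn_ge0.
have infA : has_inf A.
  by split; [exists (complex.Re (`|y - T 0| ^+ 2)), 0|exists 0].
have infq a : A a -> inf A <= q * a.
  move=> [x _ <-]; have [z] := Tq (y - T x).
  rewrite -addrA -opprD -linearD -(ReE (x + z)) -(ReE x) -rmorphM lecR.
  by apply: le_trans; apply: ge_inf; [exists 0|exists (x + z)].
have inf0 : inf A = 0.
  have infge0 : 0 <= inf A by apply: lb_le_inf Alb; case: infA.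
  have [q00|q_neq0] := eqVneq q 0.
    apply/eqP; rewrite eq_le infge0 andbT.
    by have [[a Aa] _] := infA; have := infq _ Aa; rewrite q00 mul0r.
  have q_gt0 : 0 < q by rewrite lt0r q_neq0.
  have : q^-1 * inf A <= inf A.
    apply: lb_le_inf; first by case: infA.
    by move=> a /infq; rewrite ler_pdivrMl.
  rewrite ler_pdivrMl// -subr_ge0 -{2}[inf A]mul1r -mulrBl => h.
  apply/eqP; rewrite eq_le infge0 andbT.
  rewrite -oppr_ge0 -(pmulr_rge0 _ (_ : 0 < 1 - q)) ?subr_gt0//.
  by rewrite mulrN -mulNr opprB.
have dE : (complex.Re (d ^+ 2))%:C = d ^+ 2.
  by rewrite RRe_real// gtr0_real// exprn_gt0.
have /inf_adherent/(_ infA)[_ [x _ <-]] : 0 < complex.Re (d ^+ 2).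
  by rewrite -ltcR dE exprn_gt0.
rewrite inf0 add0r -ltcR ReE dE => xd; exists x.
by rewrite -(@ltr_pXn2r _ 2)// ?nnegrE ?normr_ge0// ltW.
Qed.

(** Approximate solutions of [T x = y] are close to each other by
    [coercive_lower], hence converge. *)
Let range_full (y : H) : exists x, T x = y.
Proof.
pose S d := [set x | `|y - T x| < d].
pose F := filter_from [set d : C | 0 < d] S.
have FF : ProperFilter F.
  apply: filter_from_proper; last by move=> d /= /(dense_range y)[x]; exists x.
  apply: filter_from_filter; first by exists 1 => /=.
  move=> c d /= c0 d0; exists (Num.min c d); first by rewrite /= /Num.min; case: ifP.
  move=> x; rewrite /S/= => xcd.
  have crd : (c >=< d)%O by apply: real_comparable; exact: gtr0_real.
  by move: xcd; rewrite comparable_lt_min// => /andP[].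
have Fy : T x @[x --> F] --> y.
  apply/cvgrPdist_lt => d d0; exists d => //.
have : cvg F.
  apply: cauchy_cvg; apply/cauchy_ballP => d d0.
  have ed : 0 < e * (d / 2) by rewrite mulr_gt0// divr_gt0.
  exists (S (e * (d / 2)), S (e * (d / 2))).
    by split; exists (e * (d / 2)).
  move=> [u v] [/= Su Sv]; rewrite -ball_normE/=.
  rewrite -(ltr_pM2l e0); apply: le_lt_trans (coercive_lower _) _.
  rewrite linearB; have -> : T u - T v = (y - T v) - (y - T u).
    by rewrite opprB [RHS]addrC addrA subrK.
  apply: le_lt_trans (ler_normB _ _) _; apply: lt_le_trans (ltrD Sv Su) _.
  by rewrite -mulrDr -splitr.
move=> /cvg_ex[x Fx]; exists x.
apply: (norm_cvg_unique _ Fy).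
exact: (@continuous_cvg _ _ _ F _ id T x (@bop_continuous _ _ T x) Fx).
Qed.

Lemma coercive_invertible : invertible_op T.
Proof.
have /choice[g Tg] := range_full.
have Tinj u v : T u = T v -> u = v.
  move=> uv; apply/eqP; rewrite -subr_eq0 -normr_le0 -(pmulr_rle0 _ e0).
  by apply: le_trans (coercive_lower _) _; rewrite linearB/= uv subrr normr0.
have glin : linear g by move=> a u v; apply: Tinj; rewrite (bop_linear T) !Tg.
have gb x : `|g x| <= e^-1 * `|x|.
  by rewrite ler_pdivlMl// -{2}[x]Tg coercive_lower.
have e'0 : 0 <= e^-1 by rewrite invr_ge0 ltW.
exists (Bop (is_bopP glin e'0 gb)); split; apply: bopP => x /=; last exact: Tg.
by apply: Tinj; rewrite Tg.
Qed.
End Coercive.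
End StrictlyPositive.

(** * Unitary matrices as test operators *)

Section ScalarHilbert.
Variable R : realType.
Local Notation C := R[i].

(** [C] as a one-dimensional Hilbert space. *)
Definition scalars : Type := C^o.

HB.instance Definition _ := NormedModule.on scalars.

(** For [p] the real or the imaginary part. *)
Let part_cvg (p : C -> R) (F : set_system scalars) : ProperFilter F ->
  (forall x y, p (x - y) = p x - p y) -> (forall x, `|p x|%:C <= `|x|) ->
  cauchy F -> cvg ((p : scalars -> R) @ F).
Proof.
move=> FF pB pn /cauchy_ballP Fc; apply: cauchy_cvg; apply/cauchy_ballP => e e0.
have [|[A B] [/= FA FB] AB] := Fc e%:C; first by rewrite /= ltcR.
exists (p @` A, p @` B).
  by split => /=; [apply: filterS FA|apply: filterS FB] => x Ax; exists x.
move=> [_ _] [/= [x Ax <-] [y By <-]].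
have := AB (x, y) (conj Ax By); rewrite /= -!ball_normE/= -pB -ltcR.
by apply: le_lt_trans; exact: pn.
Qed.

Let scalars_complete (F : set_system scalars) :
  ProperFilter F -> cauchy F -> cvg F.
Proof.
move=> FF Fc; have Recvg : cvg ((@complex.Re R : scalars -> R) @ F).
  by apply: part_cvg => // [[a b] [c d]|x] //; exact: normc_ge_Re.
have Imcvg : cvg ((@complex.Im R : scalars -> R) @ F).
  apply: part_cvg => // [[a b] [c d]|x] //.
  rewrite -normrN -ReiNIm; apply: le_trans (normc_ge_Re _) _.
  by rewrite normrM complexiE normCi mulr1.
apply/cvg_ex; exists (lim ((@complex.Re R : scalars -> R) @ F) +i*
  lim ((@complex.Im R : scalars -> R) @ F) : scalars).
apply/cvgrPdist_lt => e e0.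
have eE : (complex.Re e)%:C = e by rewrite RRe_real// gtr0_real.
have e2 : 0 < complex.Re e / 2 by rewrite divr_gt0// -ltcR eE.
have /cvgrPdist_lt/(_ _ e2) Re2 := Recvg.
have /cvgrPdist_lt/(_ _ e2) Im2 := Imcvg.
near=> x.
rewrite [_ - x]complexE; apply: le_lt_trans (ler_normD _ _) _.
rewrite normrM complexiE normCi mul1r.
have cn (r : R) : `|r%:C| = `|r|%:C.
  by rewrite normc_def/= expr0n/= addr0 sqrtr_sqr.
rewrite !cn -rmorphD -eE ltcR [ltRHS]splitr ltrD// raddfB/=.
  by near: x.
by near: x.
Unshelve. all: by end_near. Qed.

HB.instance Definition _ := Uniform_isComplete.Build scalars scalars_complete.

Definition scalars_inner (x y : scalars) : C := x * (y : C)^*%R.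

Let scalars_inner_bilinear :
  bilinear_for *%R (@Num.conj C \; *%R) scalars_inner.
Proof.
split=> u a x y; rewrite /scalars_inner /=.
  by rewrite mulrDl mulrA.
by rewrite rmorphD rmorphM mulrDr mulrCA.
Qed.

HB.instance Definition _ := bilinear_isBilinear.Build C scalars scalars C
  *%R (@Num.conj C \; *%R) scalars_inner scalars_inner_bilinear.

Let scalars_inner_sym x y :
  scalars_inner x y = (-1) ^+ false * (scalars_inner y x)^*%R.
Proof. by rewrite expr0 mul1r /scalars_inner rmorphM/= conjCK mulrC. Qed.

HB.instance Definition _ := isHermitianSesquilinear.Build C scalars false
  (@Num.conj C) scalars_inner scalars_inner_sym.

Let scalars_inner_gt0 u : u != 0 -> 0 < scalars_inner u u.
Proof. by move=> u0; rewrite /scalars_inner mul_conjC_gt0. Qed.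

HB.instance Definition _ := isDotProduct.Build C scalars
  scalars_inner scalars_inner_gt0.

Let scalars_inner_norm (x : scalars) : scalars_inner x x = `|x| ^+ 2.
Proof. by rewrite /scalars_inner -normCK. Qed.

HB.instance Definition _ := isHilbert.Build R scalars scalars_inner_norm.

End ScalarHilbert.

Section ScalarMatrices.
Variables (R : realType) (H : hilbertType R) (N : nat).
Local Notation C := R[i].
Implicit Types U V : 'M[C]_N.

(** The operator [U] (x) [T] on [H^(N)]. *)
Definition tensor_mx U (T : bop H) : bop (hsum H N) :=
  mx_op (\matrix_(i, j) (U i j *: T)).

Lemma tensor_mxE U T x i : tensor_mx U T x i = \sum_j U i j *: T (x j).
Proof. by rewrite ffunE; apply: eq_bigr => j _; rewrite mxE. Qed.

Lemma tensor_mx_adjoint U : adjoint (tensor_mx U 1) = tensor_mx (U ^t*) 1.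
Proof.
apply: adjoint_uniq (adjointP _) _ => x y; rewrite !hsum_innerE.
under eq_bigr do rewrite tensor_mxE linear_sumlz.
under [RHS]eq_bigr do rewrite tensor_mxE linear_sumr.
rewrite exchange_big; apply: eq_bigr => i _; apply: eq_bigr => j _.
by rewrite linearZl_LR linearZr_LR/= !mxE conjCK.
Qed.

Lemma tensor_mxM U V : tensor_mx U 1 * tensor_mx V 1 = tensor_mx (U *m V) 1.
Proof.
apply/bopP => x; apply/ffunP => i; rewrite bopME !tensor_mxE.
under eq_bigr do rewrite tensor_mxE scaler_sumr.
rewrite exchange_big; apply: eq_bigr => j _; rewrite mxE scaler_suml.
by apply: eq_bigr => k _; rewrite scalerA.
Qed.

Lemma tensor_mx1 : tensor_mx 1%:M 1 = 1.
Proof.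
apply/bopP => x; apply/ffunP => i; rewrite tensor_mxE (bigD1 i)//= big1.
  by rewrite mxE eqxx scale1r addr0.
by move=> j ji; rewrite mxE eq_sym (negbTE ji) scale0r.
Qed.

Lemma tensor_mx_unitary U : U \is unitarymx -> unitary_op (tensor_mx U 1).
Proof.
move=> Uu; rewrite /unitary_op tensor_mx_adjoint !tensor_mxM.
have U'u : U ^t* \is unitarymx by rewrite trmxC_unitary.
by rewrite (unitarymxP Uu) -[X in _ *m X]trmxCK (unitarymxP U'u) tensor_mx1.
Qed.
End ScalarMatrices.

Section ScalarTensor.
Variables (R : realType) (H : hilbertType R) (N : nat).
Local Notation C := R[i].
Local Notation K := (hsum (scalars R) N).

(** For this map [H^(N)] is the tensor product of [H] and [C^N]. *)
Definition scalar_tensor (x : H) (y : K) : hsum H N := [ffun i => (y i : C) *: x].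

Let scalar_tensor_bilinear : bilinear_for *:%R *:%R scalar_tensor.
Proof.
split=> u a x y; apply/ffunP => i; rewrite /= !ffunE.
  by rewrite scalerDr !scalerA mulrC.
by rewrite scalerDl scalerA.
Qed.

HB.instance Definition _ := bilinear_isBilinear.Build C H K (hsum H N)
  *:%R *:%R scalar_tensor scalar_tensor_bilinear.

Lemma scalar_tensor_hilbert : is_hilbert_tensor scalar_tensor.
Proof.
split=> [x x' y y'|].
  rewrite [LHS]hsum_innerE [<<y, y'>>]hsum_innerE mulr_sumr.
  apply: eq_bigr => i _.
  by rewrite !ffunE linearZl_LR/= linearZr_LR/= mulrA mulrC.
move=> A [z Az] Ao; exists z; split=> //=.
pose e j : K := [ffun i => (i == j)%:R : C].
exists N, z, e; apply/ffunP => i.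
rewrite sum_ffunE (bigD1 i)//= !ffunE eqxx scale1r.
by rewrite big1 ?addr0// => j ji; rewrite !ffunE eq_sym (negbTE ji) scale0r.
Qed.
End ScalarTensor.

(** The double sum is the form of [\sum_k U k (x) X k], an operator on
    [H^(N)], at the vector [u]. *)
Lemma norm_le_joint_numradius (R : realType) (H : hilbertType R) m
    (X : 'I_m -> bop H) (w : R) N (U : 'I_m -> 'M[R[i]]_N) (u : 'I_N -> H) :
  (joint_numradius X <= w%:E)%E -> (forall k, U k \is unitarymx) ->
  `|\sum_k \sum_i \sum_j U k i j * <<X k (u j), u i>>| <=
    w%:C * \sum_i `|u i| ^+ 2.
Proof.
move=> Xw Uu; pose Z := \sum_k tensor_mx (U k) (X k).
pose z : hsum H N := [ffun i => u i].
have zE : \sum_i `|u i| ^+ 2 = `|z| ^+ 2.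
  by rewrite hsum_normE; apply: eq_bigr => i _; rewrite ffunE.
have -> : \sum_k \sum_i \sum_j U k i j * <<X k (u j), u i>> = <<Z z, z>>.
  rewrite bop_sumE linear_sumlz/=; apply: eq_bigr => k _.
  rewrite [RHS]hsum_innerE; apply: eq_bigr => i _; rewrite tensor_mxE linear_sumlz.
  by apply: eq_bigr => j _; rewrite /= !ffunE linearZl_LR.
rewrite zE; have [->|z0] := eqVneq z 0.
  by rewrite linear0r !normr0 expr0n mulr0.
have nz : 0 < `|z| by rewrite normr_gt0.
pose z1 := `|z|^-1 *: z.
have z1n : `|z1| = 1 by rewrite normrZ normfV normr_id mulVf// gt_eqF.
have Zz1 : `|<<Z z1, z1>>| <= w%:C.
  have : ((complex.Re `|<<Z z1, z1>>|)%:E <= w%:E)%E.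
    apply: le_trans Xw; apply: (@le_trans _ _ (numradius Z)).
      by apply: ereal_sup_ubound; exists z1.
    apply: ereal_sup_ubound.
    exists (hsum (scalars R) N), (hsum H N), (@scalar_tensor R H N),
      (fun k => tensor_mx (U k) 1), (fun k => tensor_mx (U k) (X k)).
    split=> //; first exact: scalar_tensor_hilbert.
      by move=> k; exact: tensor_mx_unitary.
    move=> k x y; apply/ffunP => i.
    rewrite tensor_mxE ffunE tensor_mxE scaler_suml.
    by apply: eq_bigr => j _; rewrite ffunE linearZ/= scalerA.
  by rewrite lee_fin -lecR RRe_real// ger0_real.
have -> : z = `|z| *: z1 by rewrite scalerA mulfV ?scale1r// gt_eqF.
rewrite [Z _]linearZ/= linearZl_LR linearZr_LR/= !normrM norm_conjC normr_id.
rewrite normrZ z1n mulr1 normr_id mulrA -expr2 mulrC.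
by rewrite ler_pM2r// exprn_gt0.
Qed.

(** * Tridiagonal operator matrices *)

Section Tridiagonal.
Variables (R : realType) (H : hilbertType R) (n : nat).
Local Notation C := R[i].
Implicit Types (A : 'I_n.+1 -> bop H) (X : 'I_n -> bop H) (v : hsum H n.+1).

Definition lo_ord (m : 'I_n) : 'I_n.+1 := widen_ord (leqnSn n) m.
Definition hi_ord (m : 'I_n) : 'I_n.+1 := lift ord0 m.

Lemma sum_superdiagonal (G : 'I_n.+1 -> 'I_n.+1 -> C) :
  \sum_(k < n.+1) \sum_(l < n.+1) (if l == k.+1 :> nat then G k l else 0) =
  \sum_m G (lo_ord m) (hi_ord m).
Proof.
rewrite big_ord_recr/= [X in _ + X]big1 ?addr0 => [|l _]; last first.
  by rewrite ltn_eqF.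
apply: eq_bigr => m _; rewrite (bigD1 (hi_ord m))//= eqxx big1 ?addr0// => l lm.
by rewrite ifN//; apply: contra lm => /eqP lm; apply/eqP/val_inj.
Qed.

(** [F] is a parameter because the sum is needed for the form of the matrix and
    for the form of its tensor products with operators. *)
Lemma sum_tridiag (F : 'I_n.+1 -> 'I_n.+1 -> bop H -> C) A X :
  (forall k l, F k l 0 = 0) ->
  \sum_k \sum_l F k l (tridiag_mx A X k l) = \sum_k F k k (A k) +
    \sum_m (F (lo_ord m) (hi_ord m) (X m) +
            F (hi_ord m) (lo_ord m) (adjoint (X m))).
Proof.
move=> F0; pose T := tridiag_mx (A : 'I_n.+1 -> _) X.
pose F1 (k l : 'I_n.+1) := if l == k.+1 :> nat then F k l (T k l) else 0.
pose F2 (k l : 'I_n.+1) := if k == l.+1 :> nat then F k l (T k l) else 0.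
pose Fd (k l : 'I_n.+1) := if k == l then F k k (A k) else 0.
transitivity (\sum_k \sum_l (Fd k l + (F1 k l + F2 k l))).
  apply: eq_bigr => k _; apply: eq_bigr => l _.
  rewrite /Fd /F1 /F2 /T mxE -val_eqE/=; have [kl|kl] := eqVneq (val k) (val l).
    rewrite kl !ltn_eqF// !addr0.
    by have -> : k = l by exact: val_inj.
  rewrite add0r; case: ifP => [/eqP lk|]; last by rewrite add0r; case: ifP.
  by rewrite lk ltn_eqF ?addr0.
under eq_bigr do rewrite big_split big_split/=.
rewrite big_split big_split/=; congr (_ + _).
  apply: eq_bigr => k _; rewrite (bigD1 k)//= /Fd eqxx big1 ?addr0// => l lk.
  by rewrite eq_sym (negbTE lk).
rewrite big_split/= sum_superdiagonal; congr (_ + _).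
  by apply: eq_bigr => m _; rewrite /T (@tridiag_mxE_sup _ _ n.+1 _ _ _ _ m).
rewrite exchange_big/= (sum_superdiagonal (fun l k => F k l (T k l))).
by apply: eq_bigr => m _; rewrite /T (@tridiag_mxE_sub _ _ n.+1 _ _ _ _ m).
Qed.

Lemma adjointC (T : bop H) x y : <<adjoint T x, y>> = (<<T y, x>>)^*%R.
Proof. by rewrite dot_conj adjointP. Qed.

Lemma tridiag_form A X v :
  <<mx_op (tridiag_mx (A : 'I_n.+1 -> _) X) v, v>> = \sum_k <<A k (v k), v k>> +
    \sum_m (<<X m (v (hi_ord m)), v (lo_ord m)>> +
            (<<X m (v (hi_ord m)), v (lo_ord m)>>)^*%R).
Proof.
rewrite [LHS]hsum_innerE.
transitivity (\sum_k \sum_l <<tridiag_mx (A : 'I_n.+1 -> _) X k l (v l), v k>>).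
  by apply: eq_bigr => k _; rewrite ffunE linear_sumlz.
rewrite (sum_tridiag (F := fun k l B => <<B (v l), v k>>)); last first.
  by move=> k l; rewrite linear0l.
by congr (_ + _); apply: eq_bigr => m _; rewrite adjointC.
Qed.

End Tridiagonal.

(** * From a positive matrix to the joint numerical radius *)

(** Peeling off the first vector [y i0]: the rest of the Gram matrix of [y] is
    the Gram matrix of the projections [y'] on the complement of [y i0], plus a
    rank one term, for which the sum is a nonnegative multiple of a value of the
    form of [S].  If [y i0 = 0], then [c = 0] and [y' = y]. *)
Lemma positive_schur_sum (R : realType) (G K : hilbertType R) (S : bop G)
    (I : Type) (s : seq I) (a : I -> G) (y : I -> K) : positive_op S ->
  0 <= \sum_(i <- s) \sum_(j <- s) <<S (a i), a j>> * <<y i, y j>>.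
Proof.
move=> Sp; elim: s y => [|i0 s IHs] y; first by rewrite big_nil.
pose g := <<y i0, y i0>>; pose c i := <<y i, y i0>> / g.
pose y' i := y i - c i *: y i0.
have gr : g^*%R = g by rewrite /g -dot_conj.
have cg i : <<y i, y i0>> = c i * g.
  have [y0|y0] := eqVneq (y i0) 0.
    by rewrite /c /g y0 !linear0r mulr0.
  by rewrite /c divfK// /g dnorm_eq0.
have cg' i : <<y i0, y i>> = (c i)^*%R * g by rewrite dot_conj cg rmorphM/= gr.
have y'0 : y' i0 = 0.
  have [y0|y0] := eqVneq (y i0) 0; first by rewrite /y' y0 scaler0 subrr.
  by rewrite /y' /c divff ?scale1r ?subrr// /g dnorm_eq0.
have yE i j : <<y i, y j>> = c i * (c j)^*%R * g + <<y' i, y' j>>.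
  rewrite /y' linearBl !linearBr/= !linearZl_LR/= !linearZr_LR/= -/g cg cg'.
  by ring.
under eq_bigr do under eq_bigr do rewrite yE mulrDr.
under eq_bigr do rewrite big_split/=.
rewrite big_split/= addr_ge0//.
  pose b := \sum_(i <- i0 :: s) c i *: a i.
  have -> : \sum_(i <- i0 :: s) \sum_(j <- i0 :: s)
      <<S (a i), a j>> * (c i * (c j)^*%R * g) = g * <<S b, b>>.
    rewrite {1}/b [S _]linear_sum linear_sumlz/= mulr_sumr; apply: eq_bigr => i _.
    rewrite linear_sumr/= mulr_sumr; apply: eq_bigr => j _.
    by rewrite [S (_ *: _)]linearZ/= linearZl_LR linearZr_LR/=; ring.
  by rewrite mulr_ge0// dnorm_ge0.
rewrite big_cons [X in X + _]big1 ?add0r; last first.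
  by move=> j _; rewrite y'0 linear0l mulr0.
under eq_bigr do rewrite big_cons y'0 linear0r mulr0 add0r.
exact: IHs.
Qed.

Section FromTridiagonal.
Variables (R : realType) (H K L : hilbertType R) (n : nat).
Variables (t : {bilinear H -> K -> L}).
Variables (A : 'I_n.+1 -> bop H) (X : 'I_n -> bop H).
Variables (U : 'I_n -> bop K) (Z : 'I_n -> bop L) (e : R[i]).
Local Notation C := R[i].
Hypotheses (tP : is_hilbert_tensor t) (UP : forall m, unitary_op (U m)).
Hypothesis (ZP : forall m, is_tensor_op t (X m) (U m) (Z m)).
Hypothesis (A1 : \sum_i A i = 1).
Hypothesis (Te : forall v : hsum H n.+1,
  e * `|v| ^+ 2 <= <<mx_op (tridiag_mx (A : 'I_n.+1 -> _) X) v, v>>).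

Let shiftE (T : bop H) x : (T - e *: (1 : bop H)) x = T x - e *: x. Proof. by []. Qed.

Let shifted_positive :
  positive_op (mx_op (tridiag_mx (fun k : 'I_n.+1 => A k - e *: (1 : bop H)) X)).
Proof.
move=> v; have := Te v; rewrite -subr_ge0 !tridiag_form addrAC.
rewrite hsum_normE mulr_sumr -sumrB; congr (0 <= _ + _).
apply: eq_bigr => k _.
by rewrite shiftE linearBl linearZl_LR/= inner_norm.
Qed.

Lemma unitary_inner (T : bop K) y y' : unitary_op T -> <<T y, T y'>> = <<y, y'>>.
Proof. by case=> T1 _; rewrite adjointP -bopME T1. Qed.

Section Chain.
Variable (l : C).
Hypothesis (l1 : `|l| = 1).

(** For [m >= n] any isometry would do. *)
Let step (m : nat) : bop K := if insub m is Some i then l *: U i else 1.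

Fixpoint chain (m : nat) : bop K :=
  if m is m'.+1 then chain m' * step m' else 1.

Lemma chain_inner m y y' : <<chain m y, chain m y'>> = <<y, y'>>.
Proof.
elim: m y y' => [//|m IHm] y y'.
rewrite -[chain m.+1]/(chain m * step m) !bopME IHm /step.
case: insubP => // i _ _; rewrite linearZl_LR linearZr_LR/= unitary_inner//.
by rewrite mulrA -normCK l1 expr1n mul1r.
Qed.

Lemma chain_step (m : 'I_n) y y' :
  <<chain m.+1 y, chain m y'>> = l * <<U m y, y'>>.
Proof. by rewrite -[chain m.+1]/(chain m * step m) bopME chain_inner /step valK linearZl_LR. Qed.

(** The shifted matrix is tested on the vector whose slots are the images of [z]
    under [1 (x) chain p]: consecutive ones differ by [l *: U m], so that the
    entries [X m] produce the tensors [X m (x) U m], while the isometries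
    disappear from the diagonal. *)
Lemma tensor_form_bound k (x : 'I_k -> H) (y : 'I_k -> K) (z : L) :
  z = \sum_i t (x i) (y i) ->
  0 <= (1 - e *+ n.+1) * `|z| ^+ 2 +
       (l * <<(\sum_m Z m) z, z>> + (l * <<(\sum_m Z m) z, z>>)^*%R).
Proof.
move=> zE; pose F (p q : 'I_n.+1) (B : bop H) :=
  \sum_i \sum_j <<B (x i), x j>> * <<chain q (y i), chain p (y j)>>.
pose B p := A p - e *: (1 : bop H).
pose a (p : 'I_n.+1 * 'I_k) : hsum H n.+1 :=
  [ffun q => if q == p.1 then x p.2 else 0].
have aE p q : a p q = if q == p.1 then x p.2 else 0 by rewrite ffunE.
pose b (p : 'I_n.+1 * 'I_k) := chain p.1 (y p.2).
have := positive_schur_sum (index_enum _) a b shifted_positive.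
have -> : \sum_p \sum_q <<mx_op (tridiag_mx B X) (a p), a q>> * <<b p, b q>> =
    \sum_p \sum_q F p q (tridiag_mx B X p q).
  rewrite exchange_big/= -(pair_bigA _ (fun p j => \sum_q
    <<mx_op (tridiag_mx B X) (a q), a (p, j)>> * <<b q, b (p, j)>>))/=.
  apply: eq_bigr => p _.
  under eq_bigr do rewrite -(pair_bigA _ (fun q i => 
    <<mx_op (tridiag_mx B X) (a (q, i)), a (p, _)>> * <<b (q, i), b (p, _)>>))/=.
  rewrite exchange_big/=; apply: eq_bigr => q _.
  rewrite exchange_big/=; apply: eq_bigr => i _; apply: eq_bigr => j _.
  congr (_ * _); rewrite hsum_innerE (bigD1 p)//= aE eqxx big1 ?addr0.
    rewrite ffunE (bigD1 q)//= aE eqxx big1 ?addr0// => r rq.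
    by rewrite aE (negbTE rq) linear0.
  by move=> r rp; rewrite aE (negbTE rp) linear0r.
rewrite sum_tridiag; last first.
  move=> p q; rewrite /F big1// => i _; rewrite big1// => j _.
  by rewrite linear0l mul0r.
have FD p q (I : finType) (G : I -> bop H) :
    F p q (\sum_i G i) = \sum_i F p q (G i).
  rewrite /F [RHS]exchange_big/=; apply: eq_bigr => i _.
  rewrite [RHS]exchange_big/=.
  by apply: eq_bigr => j _; rewrite bop_sumE linear_sumlz mulr_suml.
have innerz : `|z| ^+ 2 = \sum_i \sum_j <<x i, x j>> * <<y i, y j>>.
  rewrite -inner_norm zE linear_sumlz; apply: eq_bigr => i _.
  by rewrite linear_sumr; apply: eq_bigr => j _; rewrite /= tP.1.
have FX p : F (lo_ord p) (hi_ord p) (X p) = l * <<Z p z, z>>.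
  rewrite zE [Z p _]linear_sum linear_sumlz mulr_sumr; apply: eq_bigr => i _.
  rewrite linear_sumr mulr_sumr; apply: eq_bigr => j _.
  by rewrite /= ZP tP.1 (chain_step p) mulrCA.
have -> : \sum_p F p p (B p) = (1 - e *+ n.+1) * `|z| ^+ 2.
  transitivity (F ord0 ord0 (\sum_p B p)).
    rewrite FD; apply: eq_bigr => p _.
    apply: eq_bigr => i _; apply: eq_bigr => j _.
    by rewrite !chain_inner.
  have shiftnE u : (1 - (e *: (1 : bop H)) *+ n.+1) u = u - (e *+ n.+1) *: u.
    by rewrite scalerMnl.
  rewrite /B sumrB A1 sumr_const card_ord innerz mulr_sumr.
  apply: eq_bigr => i _; rewrite mulr_sumr; apply: eq_bigr => j _.
  by rewrite shiftnE linearBl linearZl_LR/=; ring.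
have -> // : \sum_p (F (lo_ord p) (hi_ord p) (X p) +
    F (hi_ord p) (lo_ord p) (adjoint (X p))) =
    l * <<(\sum_m Z m) z, z>> + (l * <<(\sum_m Z m) z, z>>)^*%R.
rewrite big_split/=; congr (_ + _).
  by rewrite bop_sumE linear_sumlz mulr_sumr; apply: eq_bigr => p _; exact: FX.
rewrite bop_sumE linear_sumlz mulr_sumr rmorph_sum; apply: eq_bigr => p _.
rewrite -FX /F exchange_big rmorph_sum; apply: eq_bigr => i _.
rewrite rmorph_sum; apply: eq_bigr => j _.
by rewrite rmorphM/= adjointC [<<chain _ _, _>>]dot_conj.
Qed.
End Chain.

Lemma algebraic_numradius_bound k (x : 'I_k -> H) (y : 'I_k -> K) (z : L) :
  z = \sum_i t (x i) (y i) ->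
  `|<<(\sum_m Z m) z, z>>| <= (1 - e *+ n.+1) / 2 * `|z| ^+ 2.
Proof.
move=> zE; set q := <<_, _>>.
suff [l l1 lq] : exists2 l : C, `|l| = 1 & l * q = - `|q|.
  have := tensor_form_bound l1 zE; rewrite -/q lq rmorphN/= conj_normC.
  rewrite -opprD subr_ge0 -mulr2n => h.
  by rewrite mulrAC ler_pdivlMr// mulr_natr.
(* The phase that turns the value [q] of the form into [- |q|]. *)
have [->|q0] := eqVneq q 0; first by exists 1; rewrite ?normr1 ?normr0 ?mulr0 ?oppr0.
exists (- (`|q| / q)).
  by rewrite normrN normrM normfV normr_id divff// normr_eq0.
by rewrite mulNr divfK.
Qed.

End FromTridiagonal.

Lemma dense_numradius_bound (R : realType) (L : hilbertType R) (T : bop L)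
    (D : set L) (c : R[i]) : c \is Num.real -> dense D ->
  (forall d, D d -> `|<<T d, d>>| <= c * `|d| ^+ 2) ->
  forall z, `|<<T z, z>>| <= c * `|z| ^+ 2.
Proof.
move=> cr Dd Dc z; have [r r0 Tr] := bop_bounded T.
(* [M * d] bounds the variation of both sides on a ball of radius [d <= 1]. *)
pose M := (`|c| + r) * (2 * `|z| + 1).
have M0 : 0 < M by rewrite mulr_gt0// ?ltr_wpDl// ?mulr_ge0.
have near_bound e : 0 < e -> e <= 1 -> `|<<T z, z>>| <= c * `|z| ^+ 2 + M * e.
  move=> e0 e1; have [|d [zd Dd']] := Dd (ball z e) _ (ball_open _ _).
    by exists z; exact: ballxx.
  have {}zd : `|z - d| <= e by move: zd; rewrite -ball_normE /= => /ltW.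
  have dz1 : `|d| <= `|z| + e.
    rewrite -[d in leLHS](subKr z); apply: le_trans (ler_normB _ _) _.
    by rewrite lerD2l.
  have dz2 : `|d| + `|z| <= 2 * `|z| + 1.
    rewrite mulrDl mul1r -addrA [`|z| + 1]addrC addrA lerD2r.
    by apply: le_trans dz1 _; rewrite lerD2l.
  have E : <<T z, z>> = <<T d, d>> + (<<T (z - d), z>> + <<T d, z - d>>).
    by rewrite linearB linearBl linearBr/=; ring.
  have dc : c * `|d| ^+ 2 <= c * `|z| ^+ 2 + `|c| * (2 * `|z| + 1) * e.
    rewrite -lerBlDl -mulrBr; apply: le_trans (real_ler_norm _) _.
      by rewrite realM// realB// realX// normr_real.
    rewrite normrM -mulrA ler_wpM2l// subr_sqr normrM mulrC.
    rewrite [X in X * _ <= _]ger0_norm ?addr_ge0//.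
    rewrite ler_pM ?addr_ge0//.
    by apply: le_trans (ler_dist_dist _ _) _; rewrite distrC.
  have Td : `|<<T (z - d), z>> + <<T d, z - d>>| <= r * (2 * `|z| + 1) * e.
    apply: le_trans (ler_normD _ _) _.
    apply: (@le_trans _ _ (r * `|z - d| * `|z| + r * `|d| * `|z - d|)).
      apply: lerD; apply: le_trans (inner_CauchySchwarz _ _) _.
        by rewrite ler_wpM2r.
      by rewrite ler_wpM2r.
    have -> : r * `|z - d| * `|z| + r * `|d| * `|z - d| =
        r * (`|d| + `|z|) * `|z - d|.
      by ring.
    by rewrite ler_pM ?mulr_ge0 ?addr_ge0 ?(ltW r0)// ler_pM2l.
  rewrite E; apply: le_trans (ler_normD _ _) _.
  have -> : M * e = `|c| * (2 * `|z| + 1) * e + r * (2 * `|z| + 1) * e.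
    by rewrite /M; ring.
  by rewrite addrA lerD//; exact: le_trans (Dc _ Dd') dc.
have cz : c * `|z| ^+ 2 \is Num.real by rewrite realM// realX// normr_real.
have [//|lt] := real_leP (normr_real <<T z, z>>) cz.
pose g := `|<<T z, z>>| - c * `|z| ^+ 2.
have g0 : 0 < g by rewrite subr_gt0.
have Mg : 0 < M + g by rewrite addr_gt0.
have /near_bound : 0 < g / (M + g) by rewrite divr_gt0.
rewrite ler_pdivrMr// mul1r lerDr ltW// => /(_ isT).
rewrite -lerBlDl -/g mulrCA -[X in X <= _]mulr1 ler_pM2l// ler_pdivlMr// mul1r.
by rewrite gerDl => /(lt_le_trans g0); rewrite ltxx.
Qed.

Lemma joint_numradius_lt_half (R : realType) (H : hilbertType R) n
    (A : 'I_n.+1 -> bop H) (X : 'I_n -> bop H) : \sum_i A i = 1 ->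
  positive_op (mx_op (tridiag_mx (A : 'I_n.+1 -> _) X)) ->
  invertible_op (mx_op (tridiag_mx (A : 'I_n.+1 -> _) X)) ->
  (joint_numradius X < (2^-1)%:E)%E.
Proof.
move=> A1 Tp Ti; have [e e0 Te] := strictly_positive_lower Tp Ti.
pose c := (1 - e *+ n.+1) / 2.
have er : e *+ n.+1 \is Num.real by rewrite gtr0_real// pmulrn_lgt0.
have cr : c \is Num.real by rewrite realM// realB.
apply: (@le_lt_trans _ _ (complex.Re c)%:E); last first.
  rewrite lte_fin -ltcR RRe_real//.
  have -> : (2^-1)%:C = 2^-1 :> R[i] by rewrite fmorphV rmorph_nat.
  by rewrite -[ltRHS]mul1r ltr_pM2r ?invr_gt0// gtrDl oppr_lt0 pmulrn_lgt0.
apply: ub_ereal_sup => _ [K [L [t [U [Z [tP UP ZP ->]]]]]].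
apply: ub_ereal_sup => _ [z /= z1 <-]; rewrite lee_fin -lecR !RRe_real//.
have -> : c = c * `|z| ^+ 2 by rewrite z1 expr1n mulr1.
apply: (dense_numradius_bound cr tP.2) => d [k [x [y dE]]].
exact: (algebraic_numradius_bound tP UP ZP A1 Te dE).
Qed.

(** * From the joint numerical radius to a positive matrix *)

Lemma Re_realM (R : realType) (a : R) (z : R[i]) :
  complex.Re (a%:C * z) = a * complex.Re z.
Proof. by case: z => b c /=; rewrite mul0r subr0. Qed.

Lemma Re_sum (R : realType) I (s : seq I) (F : I -> R[i]) :
  complex.Re (\sum_(i <- s) F i) = \sum_(i <- s) complex.Re (F i).
Proof. by apply: big_morph => // -[? ?] [? ?]. Qed.

Section ToTridiagonal.
Variables (R : realType) (H : hilbertType R) (n : nat) (X : 'I_n -> bop H) (w : R).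
Local Notation C := R[i].
Local Notation Hn := (hsum H n.+1).
Local Notation V := ('I_n.+1 -> H -> H -> R^o).
Hypothesis (Xw : (joint_numradius X <= w%:E)%E).

(** The diagonal blocks of the rank one operator of [v].  They are encoded by the
    real parts of their forms, so as to live in a real space of functions on
    which equality of operators is equality. *)
Definition rank_one_diag (v : Hn) : V :=
  fun k x y => complex.Re (<<x, v k>> * <<v k, y>>).
Local Notation D := rank_one_diag.

Definition const_vec (a : H) : Hn := [ffun=> a].

Definition cross (v : Hn) : C := \sum_m <<X m (v (hi_ord m)), v (lo_ord m)>>.

(** The right-hand side of a requirement.  The unknown form [f] is to satisfy
    [f (D v) = \sum_k <A k (v k), v k>], so that [f (D (const_vec a))] should be
    at most [2 w |a|^2], which says [\sum_k A k <= 2 w], and [f (- D v)] at most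
    [2 Re (cross v)], which says that the tridiagonal matrix is positive. *)
Definition cost (p : H * Hn) : R :=
  w *+ 2 * complex.Re <<p.1, p.1>> + complex.Re (cross p.2) *+ 2.

(** The cone generated by the two kinds of requirements on [f]. *)
Definition requirement (tau : V) (r : R) := exists2 s : seq (H * Hn),
  forall k x y, tau k x y + \sum_(p <- s) D p.2 k x y =
    \sum_(p <- s) D (const_vec p.1) k x y
  & r = \sum_(p <- s) cost p.

Lemma rank_one_diagZ (a : R) (v : Hn) k x y : 0 <= a ->
  D ((Num.sqrt a)%:C *: v) k x y = a * D v k x y.
Proof.
move=> a0; rewrite /D ffunE linearZl_LR linearZr_LR/=.
have -> : ((Num.sqrt a)%:C)^*%R = (Num.sqrt a)%:C.
  by apply/CrealP/complex_realP; exists (Num.sqrt a).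
rewrite mulrACA -rmorphM/= -expr2 sqr_sqrtr//.
exact: Re_realM.
Qed.

Lemma const_vecZ a u : const_vec (a *: u) = a *: const_vec u.
Proof. by apply/ffunP => k; rewrite !ffunE. Qed.

Lemma costZ (a : R) p : 0 <= a ->
  cost ((Num.sqrt a)%:C *: p.1, (Num.sqrt a)%:C *: p.2) = a * cost p.
Proof.
move=> a0; have sr : ((Num.sqrt a)%:C)^*%R = (Num.sqrt a)%:C.
  by apply/CrealP/complex_realP; exists (Num.sqrt a).
have sq z : (Num.sqrt a)%:C * ((Num.sqrt a)%:C * z) = a%:C * z.
  by rewrite mulrA -rmorphM/= -expr2 sqr_sqrtr.
have -> : cost ((Num.sqrt a)%:C *: p.1, (Num.sqrt a)%:C *: p.2) =
    w *+ 2 * complex.Re (a%:C * <<p.1, p.1>>) +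
    complex.Re (a%:C * cross p.2) *+ 2.
  rewrite /cost/= linearZl_LR linearZr_LR/= sr sq.
  congr (_ + complex.Re _ *+ 2).
  rewrite /cross mulr_sumr; apply: eq_bigr => m _.
  by rewrite !ffunE [X m _]linearZ linearZl_LR linearZr_LR/= sr sq.
by rewrite !Re_realM /cost; ring.
Qed.

Lemma requirement_cone : pos_cone requirement.
Proof.
split=> [t1 t2 _ _ [s1 E1 ->] [s2 E2 ->]|a t _ a0 [s E ->]].
  exists (s1 ++ s2); last by rewrite big_cat.
  by move=> k x y; rewrite !big_cat/= -E1 -E2 addrACA.
pose sc (p : H * Hn) := ((Num.sqrt a)%:C *: p.1, (Num.sqrt a)%:C *: p.2).
have a0' := ltW a0; exists (map sc s).
  move=> k x y; rewrite !big_map /=.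
  under eq_bigr do rewrite rank_one_diagZ//.
  under [RHS]eq_bigr do rewrite const_vecZ rank_one_diagZ//.
  by rewrite -!mulr_sumr -mulrDr E.
by rewrite big_map mulr_sumr; apply: eq_bigr => p _; rewrite costZ.
Qed.

(** This is where the joint numerical radius enters.  For [tau = 0] the family of
    the slots [k] of the vectors [p.2] has the same sum of rank one operators as
    the family of the vectors [p.1].  Hence it is a unitary transform [W k] of
    it, and the cross terms add up to the form of the operator
    [\sum_m X m (x) ((W m)^* W (m + 1))]. *)
Lemma requirement_nonneg r : requirement 0 r -> 0 <= r.
Proof.
case=> s Es ->.
pose a (j : 'I_(size s)) := (tnth (in_tuple s) j).1.
pose v k (j : 'I_(size s)) := (tnth (in_tuple s) j).2 k.
have Re_inj (F G : H -> H -> C) :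
    (forall x y, F ('i%C *: x) y = 'i%C * F x y) ->
    (forall x y, G ('i%C *: x) y = 'i%C * G x y) ->
    (forall x y, complex.Re (F x y) = complex.Re (G x y)) ->
    forall x y, F x y = G x y.
  move=> Fi Gi FG x y; have := FG ('i%C *: x) y; have := FG x y.
  rewrite Fi Gi; case: (F x y) => b c; case: (G x y) => b' c' /= -> h.
  by congr (_ +i* _); lra.
have frame k x y :
    \sum_j <<x, a j>> * <<a j, y>> = \sum_j <<x, v k j>> * <<v k j, y>>.
  apply: (Re_inj (fun x y => \sum_j <<x, a j>> * <<a j, y>>)
                 (fun x y => \sum_j <<x, v k j>> * <<v k j, y>>)).
  - move=> {}x {}y; rewrite mulr_sumr; apply: eq_bigr => j _.
    by rewrite linearZl_LR mulrA.
  - move=> {}x {}y; rewrite mulr_sumr; apply: eq_bigr => j _.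
    by rewrite linearZl_LR mulrA.
  move=> {}x {}y; have := Es k x y.
  rewrite (_ : (0 : V) k x y = 0)// add0r.
  rewrite [X in X = _]big_tnth [X in _ = X]big_tnth => E.
  rewrite !Re_sum -[RHS]/(\sum_j D (tnth (in_tuple s) j).2 k x y) E.
  by apply: eq_bigr => j _; rewrite /D !ffunE.
have /choice[W WP] : forall k, exists W : 'M[C]_(size s), W \is unitarymx /\
    forall i, v k i = \sum_j W i j *: a j.
  by move=> k; have [W Wu WE] := unitarily_equivalent_families (frame k); exists W.
pose U m := (W (lo_ord m)) ^t* *m W (hi_ord m).
have Uu m : U m \is unitarymx.
  have [Wl _] := WP (lo_ord m); have [Wh _] := WP (hi_ord m).
  by apply: mul_unitarymx Wh; rewrite trmxC_unitary.
have := norm_le_joint_numradius a Xw Uu.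
have -> : \sum_k \sum_i \sum_j U k i j * <<X k (a j), a i>> = \sum_(p <- s) cross p.2.
  rewrite [RHS]big_tnth [RHS]exchange_big/=; apply: eq_bigr => m _.
  have -> : \sum_(l < size s) <<X m ((tnth (in_tuple s) l).2 (hi_ord m)),
      (tnth (in_tuple s) l).2 (lo_ord m)>> =
    \sum_l \sum_i \sum_j
      (W (lo_ord m) l i)^*%R * W (hi_ord m) l j * <<X m (a j), a i>>.
    apply: eq_bigr => l _; rewrite -/(v (hi_ord m) l) -/(v (lo_ord m) l).
    rewrite !(WP _).2 linear_sumr; apply: eq_bigr => i _.
    rewrite [X m _]linear_sum linear_sumlz; apply: eq_bigr => j _.
    rewrite /= [X m (_ *: _)]linearZ/= linearZl_LR linearZr_LR/= mulrA.
    by rewrite [_ * W _ _ _]mulrC.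
  rewrite [RHS]exchange_big; apply: eq_bigr => i _.
  rewrite [RHS]exchange_big; apply: eq_bigr => j _.
  rewrite /U mxE mulr_suml; apply: eq_bigr => l _.
  by rewrite !mxE.
set Q := \sum_(p <- s) _ => Qw.
have aE : \sum_i `|a i| ^+ 2 = (\sum_(p <- s) complex.Re <<p.1, p.1>>)%:C.
  rewrite rmorph_sum/= [RHS]big_tnth; apply: eq_bigr => i _.
  by rewrite RRe_real ?inner_norm// inner_norm realX// normr_real.
move: Qw; rewrite aE -rmorphM/= => Qw.
have {}Qw : `|complex.Re Q| <= w * \sum_(p <- s) complex.Re <<p.1, p.1>>.
  by rewrite -lecR; apply: le_trans Qw; exact: normc_ge_Re.
rewrite big_split/= -mulr_sumr sumrMnl -(Re_sum s (fun p => cross p.2)) -/Q.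
move: Qw; rewrite ler_norml => /andP[Qw _].
by rewrite mulrnAl -mulrnDl mulrn_wge0// -lerBlDl sub0r.
Qed.

Lemma requirement0 : requirement 0 0.
Proof. by exists [::] => [k x y|]; rewrite !big_nil// addr0. Qed.

(** [- D (const_vec a)] is compensated by the vector [const_vec a].  As for [D v],
    its block in slot [k] becomes a full [const_vec (v k)] after adding the
    vector with [v k] in all other slots. *)
Lemma requirement_ex (s : seq (H * Hn)) : exists r,
  requirement (\sum_(p <- s) (D p.2 - D (const_vec p.1))) r.
Proof.
elim: s => [|p s [r rs]]; first by exists 0; rewrite big_nil; exact: requirement0.
rewrite big_cons.
suff [r' pr'] : exists r', requirement (D p.2 - D (const_vec p.1)) r'.
  by exists (r' + r); exact: requirement_cone.1.
pose q k : H * Hn := (p.2 k, [ffun l => if l == k then 0 else p.2 k]).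
pose s' := (0, const_vec p.1) :: [seq q k | k <- index_enum 'I_n.+1].
exists (\sum_(p <- s') cost p), s' => // k x y.
rewrite !big_cons !big_map /=.
have -> : D (const_vec 0) k x y = 0 by rewrite /D ffunE linear0r mul0r.
rewrite add0r addrA [_ + D (const_vec p.1) k x y]subrK.
rewrite (bigD1 k)//= [RHS](bigD1 k)//=.
have -> : D [ffun l => if l == k then 0 else p.2 k] k x y = 0.
  by rewrite /D ffunE eqxx linear0r mul0r.
have -> : D (const_vec (p.2 k)) k x y = D p.2 k x y by rewrite /D ffunE.
rewrite add0r; congr (_ + _); apply: eq_bigr => l lk.
by rewrite /D !ffunE eq_sym (negbTE lk).
Qed.

Lemma requirement_consistent : consistent requirement.
Proof.
split; [exact: requirement0|exact: requirement_cone|exact: requirement_nonneg|].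
move=> t _ [s Es _]; have [r sr] := requirement_ex s; exists r.
suff -> : - t = \sum_(p <- s) (D p.2 - D (const_vec p.1)) by [].
apply/funext => k; apply/funext => x; apply/funext => y.
rewrite sumrB.
have sumE (F : H * Hn -> V) :
    (\sum_(p <- s) F p) k x y = \sum_(p <- s) F p k x y.
  by elim/big_rec2: _ => // p u v _ <-.
rewrite [RHS]/((\sum_(p <- s) D p.2) k x y -
  (\sum_(p <- s) D (const_vec p.1)) k x y).
by rewrite !sumE -Es [RHS]addrC opprD subrK.
Qed.

End ToTridiagonal.

Section SlotOperators.
Variables (R : realType) (H : hilbertType R) (n : nat) (X : 'I_n -> bop H) (w : R).
Local Notation C := R[i].
Local Notation Hn := (hsum H n.+1).
Local Notation V := ('I_n.+1 -> H -> H -> R^o).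
Local Notation D := (@rank_one_diag R H n).
Hypothesis (w0 : 0 <= w) (Xw : (joint_numradius X <= w%:E)%E).

(** Polarization of [D] at the vectors with one nonzero slot, symmetric in [u]
    and [v] so that any linear form turns it into a symmetric form. *)
Definition slot_form (k : 'I_n.+1) (u v : H) : V := fun l x y =>
  if l == k then complex.Re (<<x, u>> * <<v, y>> + <<x, v>> * <<u, y>>) / 2
  else 0.

Lemma slot_formP k a u v z :
  slot_form k (a%:C *: u + v) z = a *: slot_form k u z + slot_form k v z.
Proof.
apply/funext => l; apply/funext => x; apply/funext => y.
rewrite [RHS]/(a * slot_form k u z l x y + slot_form k v z l x y) /slot_form.
case: eqP => _; last by rewrite mulr0; exact/esym/addr0.
have ar : (a%:C)^*%R = a%:C by apply/CrealP/complex_realP; exists a.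
rewrite linearDr linearZr_LR linearDl linearZl_LR/= ar.
transitivity ((a * complex.Re (<<x, u>> * <<z, y>> + <<x, z>> * <<u, y>>) +
    complex.Re (<<x, v>> * <<z, y>> + <<x, z>> * <<v, y>>)) / 2); last first.
  by rewrite mulrDl mulrA.
rewrite -Re_realM; congr (_ / 2).
case: <<x, u>> => ? ?; case: <<x, v>> => ? ?; case: <<x, z>> => ? ?.
by case: <<z, y>> => ? ?; case: <<u, y>> => ? ?; case: <<v, y>> => ? ? /=; ring.
Qed.

Lemma slot_formC k u v : slot_form k u v = slot_form k v u.
Proof.
by apply/funext => l; apply/funext => x; apply/funext => y; rewrite /slot_form addrC.
Qed.

Lemma slot_form_i k u v :
  slot_form k ('i%C *: u) ('i%C *: v) = slot_form k u v.
Proof.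
apply/funext => l; apply/funext => x; apply/funext => y; rewrite /slot_form.
case: eqP => // _; congr (complex.Re _ / 2).
rewrite !linearZr_LR !linearZl_LR/=.
have ii : ('i%C)^*%R * 'i%C = 1 :> C.
  by rewrite mulrC -normCK complexiE normCi expr1n.
by rewrite !mulrA ![('i%C)^*%R * _ * 'i%C]mulrAC ii !mul1r.
Qed.

Definition slot_vec (k : 'I_n.+1) (u : H) : Hn :=
  [ffun l => if l == k then u else 0].

Lemma rank_one_diag_slot k u : D (slot_vec k u) = slot_form k u u.
Proof.
apply/funext => l; apply/funext => x; apply/funext => y.
rewrite /rank_one_diag /slot_form ffunE.
case: eqP => _; last by rewrite linear0r mul0r.
by case: (_ * _) => b c /=; rewrite -mulr2n -[b *+ 2]mulr_natr mulfK ?pnatr_eq0.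
Qed.

Lemma rank_one_diag_sum (v : Hn) : D v = \sum_k slot_form k (v k) (v k).
Proof.
apply/funext => l; apply/funext => x; apply/funext => y.
have sumE (F : 'I_n.+1 -> V) : (\sum_k F k) l x y = \sum_k F k l x y.
  by elim/big_rec2: _ => // p u z _ <-.
rewrite sumE (bigD1 l)//= big1 ?addr0.
  by rewrite -rank_one_diag_slot /rank_one_diag ffunE eqxx.
by move=> k kl; rewrite /slot_form eq_sym (negbTE kl).
Qed.

Lemma cross0 : cross X 0 = 0.
Proof. by rewrite /cross big1// => m _; rewrite !ffunE linear0r. Qed.

Lemma cross_slot k u : cross X (slot_vec k u) = 0.
Proof.
rewrite /cross big1// => m _; rewrite !ffunE.
case: eqP => [<-|_]; last by rewrite linear0 linear0l.
by rewrite -val_eqE/= ltn_eqF// linear0r.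
Qed.

(** The operator [A k] is the value of the form [f] of the extension theorem on
    the vectors concentrated in slot [k].  It is positive because these have no
    cross terms. *)
Lemma slot_operators : exists A : 'I_n.+1 -> bop H,
  [/\ forall k u, 0 <= <<A k u, u>>,
      forall u, \sum_k <<A k u, u>> <= (w *+ 2)%:C * `|u| ^+ 2 &
      forall v : Hn,
        0 <= \sum_k <<A k (v k), v k>> + (cross X v + (cross X v)^*%R)].
Proof.
have [f [flin fle]] := cone_extension (requirement_consistent Xw).
have f0 : f 0 = 0.
  by have := flin (-1) 0 0; rewrite scaler0 addr0 mulN1r addNr.
have fD x y : f (x + y) = f x + f y by rewrite -[x]scale1r flin mul1r scale1r.
have fN x : f (- x) = - f x by apply/eqP; rewrite -addr_eq0 -fD addNr f0.
have fsum (F : 'I_n.+1 -> V) : f (\sum_k F k) = \sum_k f (F k).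
  exact: big_morph.
pose b k u v := f (slot_form k u v).
have fdiag (v : Hn) : f (D v) = \sum_k b k (v k) (v k).
  by rewrite rank_one_diag_sum fsum.
have fconst u : \sum_k b k u u <= w *+ 2 * complex.Re <<u, u>>.
  have -> : \sum_k b k u u = f (D (const_vec n u)).
    by rewrite fdiag; apply: eq_bigr => k _; rewrite ffunE.
  apply: fle; exists [:: (u, 0)] => [k x y|]; rewrite !big_cons !big_nil/=.
    rewrite !addr0 /rank_one_diag [X in _ + X](_ : _ = 0) ?addr0//.
    by rewrite !ffunE linear0r mul0r.
  by rewrite /cost/= cross0 mul0rn !addr0.
have fcross v : 0 <= f (D v) + complex.Re (cross X v) *+ 2.
  rewrite addrC -lerBlDr sub0r -fN; apply: fle; exists [:: (0, v)] => [k x y|].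
    rewrite !big_cons !big_nil/= !addr0 [LHS](_ : _ = 0); last exact: addNr.
    by rewrite /rank_one_diag ffunE linear0r mul0r.
  by rewrite big_cons big_nil /cost/= linear0l mulr0 add0r addr0.
have b0 k u : 0 <= b k u u.
  have := fcross (slot_vec k u).
  by rewrite cross_slot mul0rn addr0 rank_one_diag_slot.
have ReE u : (complex.Re <<u, u>>)%:C = `|u| ^+ 2.
  by rewrite inner_norm RRe_real// realX// normr_real.
have /choice[A AE] : forall k, exists T : bop H,
    forall u, <<T u, u>> = (b k u u)%:C.
  move=> k; apply: (@form_operator _ _ (b k) (w *+ 2)) => //.
  - by rewrite mulrn_wge0.
  - by move=> a u v z; rewrite /b slot_formP flin.
  - by move=> u v; rewrite /b slot_formC.
  - by move=> u v; rewrite /b slot_form_i.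
  - move=> u; rewrite -ReE -rmorphM lecR; apply: le_trans (fconst u).
    by rewrite (bigD1 k)//= lerDl sumr_ge0.
exists A; split=> [k u|u|v].
- by rewrite AE lecR.
- under eq_bigr do rewrite AE.
  by rewrite -rmorph_sum -ReE -rmorphM lecR.
- under eq_bigr do rewrite AE.
  rewrite -rmorph_sum -fdiag.
  have -> : cross X v + (cross X v)^*%R = (complex.Re (cross X v) *+ 2)%:C.
    case: (cross X v) => c d; apply/eqP.
    by rewrite eq_complex/= mulr2n subrr !eqxx.
  by rewrite -rmorphD lecR.
Qed.
End SlotOperators.

(** The operators [A k] have sum at most [2 w < 1], and the difference is shared
    equally among them as [S]. *)
Lemma joint_numradius_tridiag (R : realType) (H : hilbertType R) n
    (X : 'I_n -> bop H) : (joint_numradius X < (2^-1)%:E)%E ->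
  exists A : 'I_n.+1 -> bop H,
    [/\ forall i, positive_op (A i) /\ invertible_op (A i),
        \sum_i A i = 1,
        positive_op (mx_op (tridiag_mx (A : 'I_n.+1 -> _) X)) &
        invertible_op (mx_op (tridiag_mx (A : 'I_n.+1 -> _) X))].
Proof.
move=> Xlt; have [w [w0 w2 Xw]] : exists w : R,
    [/\ 0 <= w, w *+ 2 < 1 & (joint_numradius X <= w%:E)%E].
  move: Xlt; case: (joint_numradius X) => [r| |].
  - rewrite lte_fin => r2; exists (Num.max r 0); split.
    + by rewrite le_max lexx orbT.
    + by rewrite -mulr_natr -ltr_pdivlMr// mul1r gt_max r2 invr_gt0 ltr0n.
    + by rewrite lee_fin le_max lexx.
  - by rewrite ltNge leey.
  - by exists 0; rewrite mul0rn lexx ltr01 leNye.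
have [A [A0 Asum AX]] := slot_operators w0 Xw.
have N0 : 0 < n.+1%:R^-1 :> R[i] by rewrite invr_gt0.
pose S : bop H := n.+1%:R^-1 *: (1 - \sum_i A i).
pose e : R[i] := n.+1%:R^-1 * (1 - (w *+ 2)%:C).
have e0 : 0 < e by rewrite mulr_gt0// subr_gt0 ltcR.
have Se u : e * `|u| ^+ 2 <= <<S u, u>>.
  have -> : <<S u, u>> = n.+1%:R^-1 * (`|u| ^+ 2 - \sum_i <<A i u, u>>).
    rewrite [S u]/(n.+1%:R^-1 *: (u - (\sum_i A i) u)) linearZl_LR linearBl/=.
    by rewrite bop_sumE linear_sumlz inner_norm.
  by rewrite /e -mulrA ler_pM2l// mulrBl mul1r lerB.
have A'e k u : e * `|u| ^+ 2 <= <<(A k + S) u, u>>.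
  by rewrite bopDE linearDl/= -[leLHS]add0r lerD.
pose T := mx_op (tridiag_mx (fun k : 'I_n.+1 => A k + S) X).
have Te v : e * `|v| ^+ 2 <= <<T v, v>>.
  rewrite tridiag_form hsum_normE mulr_sumr big_split/= -rmorph_sum -/(cross X v).
  have -> : \sum_k <<(A k + S) (v k), v k>> =
      \sum_k <<S (v k), v k>> + \sum_k <<A k (v k), v k>>.
    by rewrite -big_split; apply: eq_bigr => k _; rewrite bopDE linearDl addrC.
  rewrite -addrA -[leLHS]addr0 lerD//.
  by apply: ler_sum => k _.
have ge0 (L : hilbertType R) (B : bop L) :
    (forall u, e * `|u| ^+ 2 <= <<B u, u>>) -> positive_op B.
  by move=> Be u; apply: le_trans (Be u); rewrite mulr_ge0 ?exprn_ge0 ?(ltW e0).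
exists (fun k => A k + S); split.
- by move=> k; split; [exact: ge0 (A'e k)|exact: coercive_invertible e0 (A'e k)].
- rewrite big_split/= sumr_const card_ord /S scalerMnl -mulr_natr mulVf//.
  by rewrite scale1r addrC subrK.
- exact: ge0 Te.
- exact: coercive_invertible e0 Te.
Qed.

Theorem theorem3p4 (R : realType) (H : hilbertType R) (n : nat)
    (n_ge2 : (2 <= n)%N) (X : 'I_n.-1 -> bop H) :
  (joint_numradius X < (2^-1)%:E)%E <->
  exists A : 'I_n -> bop H,
    [/\ forall i, positive_op (A i) /\ invertible_op (A i),
        \sum_i A i = 1,
        positive_op (mx_op (tridiag_mx A X)) &
        invertible_op (mx_op (tridiag_mx A X))].
Proof.
case: n n_ge2 X => [//|n] _ X; split; first exact: joint_numradius_tridiag.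
by case=> A [_ A1 Tp Ti]; exact: joint_numradius_lt_half A1 Tp Ti.
Qed.
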